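(* Let $\mathcal{D}$ be the Dirichlet space on the open unit disk $\mathbb{D}$. Let $\Lambda:\mathcal{D}\to\mathbb{C}$ be a linear functional (not assumed continuous) such that $\Lambda(1)=1$ and $\Lambda(g)\neq 0$ for all nowhere-vanishing functions $g\in\mathcal{D}$. Then there exists $a\in\mathbb{D}$ such that $\Lambda(f)=f(a)$ for all $f\in\mathcal{D}$.
   Context: $\mathbb{D}=\{z\in\mathbb{C}:|z|<1\}$, and $\mathrm{Hol}(\mathbb{D})$ is the set of holomorphic functions $\mathbb{D}\to\mathbb{C}$. For $f\in\mathrm{Hol}(\mathbb{D})$ the Dirichlet integral is $\mathcal{D}(f):=\frac{1}{\pi}\int_{\mathbb{D}}|f'(z)|^2\,dA(z)$, where $dA$ is area (planar Lebesgue) measure. The Dirichlet space is the complex vector space $\mathcal{D}:=\{f\in\mathrm{Hol}(\mathbb{D}):\mathcal{D}(f)<\infty\}$. The symbol $1$ in $\Lambda(1)$ denotes the constant function $1$. A function $g$ is nowhere-vanishing if $g(z)\neq 0$ for all $z\in\mathbb{D}$. Linear means complex-linear. *)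

(* Defs.v *)
From HB Require Import structures.
From mathcomp Require Import all_boot all_order all_algebra.
From mathcomp Require Import ring complex.
From mathcomp Require Import all_classical all_reals all_analysis.
From mathcomp Require Import measurable_realfun.

Set Implicit Arguments.
Unset Strict Implicit.
Unset Printing Implicit Defensive.

Import Order.TTheory GRing.Theory Num.Theory.
Import numFieldNormedType.Exports.

Local Open Scope classical_set_scope.
Local Open Scope ring_scope.
Local Open Scope complex_scope.

(* R[i] as a normed module over itself: the library only provides this for
   types that are syntactically the carrier of an abstract numFieldType.
   [derivable] and [derive1] on R[i] -> R[i] thus refer to the complex
   derivative. *)
HB.instance Definition _ (R : rcfType) := GRing.ComAlgebra.copy R[i] R[i]^o.
HB.instance Definition _ (R : rcfType) := Vector.copy R[i] R[i]^o.
HB.instance Definition _ (R : rcfType) := NormedModule.copy R[i] R[i]^o.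

Definition disc (R : rcfType) : set R[i] := [set z | `|z| < 1].
Arguments disc : clear implicits.

Section dirichlet_def.
Variable R : realType.
Implicit Types f : disc R -> R[i].

Definition toC (p : R * R) : R[i] := p.1 +i* p.2.

(* ['valL_0 f] extends f by 0 outside the disc; as the disc is open, this does
   not affect the derivatives at points of the disc. *)
Definition holomorphic_disc f :=
  forall z, disc R z -> derivable ('valL_0 f) z 1.

Definition area :
    {measure set (measurableTypeR R * measurableTypeR R) -> \bar R} :=
  (@lebesgue_measure R \x @lebesgue_measure R)%E.

Definition planar_disc : set (R * R) := toC @^-1` disc R.

(* [Normc.normc] is the modulus with values in R, [`|_|] the one in R[i]. *)
Definition dirichlet_integral f : \bar R :=
  ((pi^-1)%:E * \int[area]_(p in planar_disc)
     (Normc.normc (('valL_0 f)^`()%classic (toC p)) ^+ 2)%:E)%E.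

Definition in_dirichlet : {pred disc R -> R[i]} := fun f =>
  `[< holomorphic_disc f /\ (dirichlet_integral f < +oo)%E >].

End dirichlet_def.
Arguments planar_disc : clear implicits.
Arguments area : clear implicits.
Arguments in_dirichlet : clear implicits.

Section dirichlet_closed.
Variable R : realType.
Local Notation mR := (measurableTypeR R).
Local Notation mR2 := (mR * mR)%type.
Implicit Types f g : disc R -> R[i].

Lemma valL_lin a f g :
  'valL_0 (a *: f + g) = a *: 'valL_0 f + 'valL_0 g :> (R[i] -> R[i]).
Proof.
apply/funext => z; rewrite !fctE /valL_ /=.
by case: ('oinv_set_val z) => [u|] /=; rewrite ?scaler0 ?addr0.
Qed.

Let ltrBl (x e : R) : 0 < e -> x - e < x. Proof. by rewrite ltrBlDr ltrDl. Qed.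
Let ltrDr (x e : R) : 0 < e -> x < x + e. Proof. by rewrite ltrDl. Qed.

Lemma open_measurable2 (U : set (R * R)) : open U -> measurable (U : set mR2).
Proof.
move=> oU.
pose B (q : rat * rat * rat * rat) : set (R * R) :=
  `]ratr q.1.1.1, ratr q.1.1.2[%classic `*` `]ratr q.1.2, ratr q.2[%classic.
rewrite (_ : U = \bigcup_q (if `[< B q `<=` U >] then B q else set0)); last first.
  apply/seteqP; split => [[x y] Uxy|p [q _]]; last by case: ifPn => [/asboolP BU Bp|_ []]; exact: BU.
  have : nbhs (x, y) U by exact: open_nbhs_nbhs.
  move=> [] [A C] /= [/nbhs_ballP[e /= e0 eA] /nbhs_ballP[d /= d0 dC] ACU].
  have [a ] := @rat_in_itvoo R _ _ (ltrBl x e0).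
  rewrite in_itv /= => /andP[a1 a2].
  have [b ] := @rat_in_itvoo R _ _ (ltrDr x e0).
  rewrite in_itv /= => /andP[b1 b2].
  have [s ] := @rat_in_itvoo R _ _ (ltrBl y d0).
  rewrite in_itv /= => /andP[s1 s2].
  have [t ] := @rat_in_itvoo R _ _ (ltrDr y d0).
  rewrite in_itv /= => /andP[t1 t2].
  exists (a, b, s, t) => //.
  rewrite asboolT; first by split; rewrite /= in_itv /=; apply/andP.
  move=> [u v] [] /=; rewrite !in_itv /= => /andP[u1 u2] /andP[v1 v2].
  apply: (ACU (u, v)); split => /=.
    apply: eA; rewrite /ball /= ltr_distlC; apply/andP; split.
      exact: lt_trans u1.
    exact: lt_trans b2.
  apply: dC; rewrite /ball /= ltr_distlC; apply/andP; split.
    exact: lt_trans v1.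
  exact: lt_trans t2.
apply: countable_bigcupT_measurable; first exact: countableP.
move=> q; case: ifP => _ //.
by apply: measurableX; exact: measurable_itv.
Qed.

Lemma nbhs_complexP (z : R[i]) (A : set R[i]) :
  nbhs z A -> exists2 r : R, 0 < r & forall w, Normc.normc (z - w) < r -> A w.
Proof.
move=> /nbhs_ballP [e /= e0 eA]; exists (complex.Re e).
  by move: e0; rewrite ltcE /= => /andP[].
move=> w zw; apply: eA; rewrite /ball /=.
have -> : e = (complex.Re e)%:C.
  by apply/eqP; rewrite eq_complex /=; move: e0; rewrite ltcE /= => /andP[/eqP -> _]; rewrite !eqxx.
by rewrite ltcE /= eqxx.
Qed.

Lemma normc_le (a b : R) : Normc.normc (a +i* b) <= `|a| + `|b|.
Proof.
rewrite /= -(@ler_pXn2r _ 2) ?nnegrE ?sqrtr_ge0 ?addr_ge0// sqr_sqrtr ?addr_ge0 ?sqr_ge0//.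
by rewrite sqrrD !real_normK ?num_real// -addrA lerD2l lerDr mulrn_wge0// mulr_ge0.
Qed.

Lemma continuous_toC : continuous (@toC R).
Proof.
move=> [x y] A /nbhs_complexP [r r0 rA].
have r20 : 0 < r / 2 by rewrite divr_gt0.
exists (ball x (r / 2), ball y (r / 2)).
  by split; apply/nbhs_ballP; exists (r / 2).
move=> [u v] [] /= xu yv; apply: rA; rewrite /toC /=.
apply: le_lt_trans (normc_le _ _) _.
by rewrite [r]splitr ltrD.
Qed.

Lemma cts_Re : continuous (@complex.Re R : R[i] -> R).
Proof.
move=> z A /nbhs_ballP [e /= e0 eA].
apply/nbhs_ballP; exists e%:C; first by rewrite /= ltcR.
move=> w; rewrite /ball /= => zw; apply: eA; rewrite /ball /=.
have := le_lt_trans (normc_ge_Re (z - w)) zw.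
by rewrite ltcR raddfB.
Qed.

Lemma cts_Im : continuous (@complex.Im R : R[i] -> R).
Proof.
move=> z A /nbhs_ballP [e /= e0 eA].
apply/nbhs_ballP; exists e%:C; first by rewrite /= ltcR.
move=> w; rewrite /ball /= => zw; apply: eA; rewrite /ball /=.
have := normc_ge_Re ('i * (z - w)); rewrite normrM.
have -> : `|'i : R[i]| = 1 by rewrite normc_def /= expr0n expr1n add0r sqrtr1.
rewrite mul1r => /le_lt_trans => /(_ _ zw).
rewrite ltcR; case: z w {zw} => [a b] [c d] /=.
by rewrite !mul0r !mul1r sub0r normrN.
Qed.

Lemma open_disc : open (disc R).
Proof.
have -> : disc R = ball (0 : R[i]) 1.
  by apply/seteqP; split => z; rewrite /disc /ball /= sub0r normrN.
exact: ball_open.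
Qed.

Lemma open_planar : open (planar_disc R : set (R * R)).
Proof.
apply: (@open_comp _ _ (@toC R)); last exact: open_disc.
by move=> p _; exact: continuous_toC.
Qed.

Lemma measurable_planar : measurable (planar_disc R : set mR2).
Proof. apply: open_measurable2; exact: open_planar. Qed.

Lemma open_cts_measurable2 (D : set (R * R)) (h : R * R -> R) : open D ->
  {in D, continuous h} -> measurable_fun (D : set mR2) (h : mR2 -> R).
Proof.
move=> oD ch mD; apply: (measurability _ (RGenOpens.measurableE R)) => //.
move=> _ [_ [a [b ->] <-]]; apply: open_measurable2.
rewrite openE => p [Dp hp]; apply: filterI; first exact: open_nbhs_nbhs.
by apply: ch; [rewrite inE|exact: open_nbhs_nbhs].
Qed.


Lemma measurable_derive_aux (re : R[i] -> R) f : holomorphic_disc f ->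
  continuous re ->
  (forall (x : R) z, re (x%:C * z) = x * re z) -> {morph re : x y / x - y} ->
  measurable_fun (planar_disc R : set mR2)
    (fun p => re (('valL_0 f)^`()%classic (toC p)) : R).
Proof.
move=> hf cre reM reB.
have re0 : re 0 = 0 by rewrite -[X in re X](subrr 0) reB subrr.
set F : R[i] -> R[i] := 'valL_0 f.
have F0 z : ~ disc R z -> F z = 0.
  move=> Dz; rewrite /F /valL_ /= oinv_set_val insubN //.
  by apply/negP => /set_mem.
pose g (p : R * R) := re (F (toC p)).
have mg : measurable_fun [set: mR2] (g : mR2 -> R).
  have -> : g = (g \_ (planar_disc R)).
    apply/funext => p; rewrite /patch; case: ifPn => //.
    by move=> /negP Dp; rewrite /g F0 // => Dp'; apply: Dp; rewrite inE.
  apply/(measurable_restrictT _ measurable_planar).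
  apply: open_cts_measurable2; first exact: open_planar.
  move=> p; rewrite inE => Dp.
  apply: continuous_comp; last exact: cre.
  apply: continuous_comp; first exact: continuous_toC.
  apply: differentiable_continuous; apply/derivable1_diffP; exact: hf.
have mgs (c : R) : measurable_fun [set: mR2] ((fun p : R * R => g (p.1 + c, p.2)) : mR2 -> R).
  have mt : measurable_fun [set: mR2] (fun p : mR2 => ((p.1 : R) + c, p.2) : mR2).
    apply: measurable_fun_pair; last exact: measurable_snd.
    by apply: measurable_funD; [exact: measurable_fst|exact: measurable_cst].
  exact: (measurableT_comp mg mt).
pose h n (p : R * R) : R := (n.+1%:R : R) * (g (p.1 + n.+1%:R^-1, p.2) - g p).
apply: (@measurable_fun_cvg _ mR2 R _ h).
  move=> n; apply: measurable_funTS; apply: measurable_funM; first exact: measurable_cst.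
  by apply: measurable_funB.
move=> p Dp.
have d : derivable F (toC p) 1 by exact: hf.
have lim1 : (fun n => (n.+1%:R^-1 : R)%:C : R[i]) @ \oo --> (0 : R[i])^'.
  move=> A /nbhs_complexP [r r0 rA].
  change (\forall n \near \oo, A ((n.+1%:R^-1 : R)%:C)).
  near=> n; apply: rA; last first.
    by rewrite eq_complex negb_and /= invr_eq0 pnatr_eq0.
  rewrite sub0r /= oppr0 sqrrN [0 ^+ 2]expr0n addr0 sqrtr_sqr ger0_norm ?invr_ge0//.
  near: n; exact: near_infty_natSinv_lt (PosNum r0).
have -> : h ^~ p = re \o (fun k : R[i] => k^-1 *: (F (k + toC p) - F (toC p))) \o (fun n => (n.+1%:R^-1 : R)%:C).
  apply/funext => n; rewrite /h /= -fmorphV /= invrK.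
  rewrite -[X in _ = re X]/(_ * _) reM reB /g; congr (_ * (re (F _) - _)).
  by rewrite /toC /=; apply/eqP; rewrite eq_complex /= add0r addrC !eqxx.
have H : (fun n => (fun k : R[i] => k^-1 *: (F (k + toC p) - F (toC p))) (n.+1%:R^-1 : R)%:C)
     @ \oo --> (F^`()%classic (toC p) : R[i]).
  apply: (@cvg_comp _ _ _ (fun n => (n.+1%:R^-1 : R)%:C : R[i])
    (fun k : R[i] => k^-1 *: (F (k + toC p) - F (toC p))) \oo _ _ lim1).
  rewrite /derive1; move: d; rewrite /derivable.
  under eq_fun do rewrite /= -[_ *: 1]/(_ * _) mulr1.
  by [].
exact: (@continuous_cvg _ _ _ \oo _ _ re _ (cre _) H).
Unshelve. all: by end_near. Qed.

Lemma measurable_derive f : holomorphic_disc f ->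
  measurable_fun (planar_disc R : set mR2)
    (fun p => Normc.normc (('valL_0 f)^`()%classic (toC p)) ^+ 2 : R).
Proof.
move=> hf.
have -> : (fun p => Normc.normc (('valL_0 f)^`()%classic (toC p)) ^+ 2) =
   (fun p => complex.Re (('valL_0 f)^`()%classic (toC p)) ^+ 2 +
             complex.Im (('valL_0 f)^`()%classic (toC p)) ^+ 2) :> (mR2 -> R).
  apply/funext => p; case: (_ (toC p)) => a b /=.
  by rewrite sqr_sqrtr // addr_ge0 ?sqr_ge0.
apply: measurable_funD; apply: measurable_funX; apply: measurable_derive_aux => //.
- exact: cts_Re.
- by move=> x [a b] /=; rewrite mul0r subr0.
- by move=> [a b] [c d].
- exact: cts_Im.
- by move=> x [a b] /=; rewrite mul0r addr0.
- by move=> [a b] [c d].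
Qed.

Lemma dirichlet_fin f : (dirichlet_integral f < +oo)%E <->
  (\int[area R]_(p in planar_disc R)
     (Normc.normc (('valL_0 f)^`()%classic (toC p)) ^+ 2)%:E < +oo)%E.
Proof.
split; rewrite /dirichlet_integral => h; last first.
  by apply: lte_mul_pinfty h => //; rewrite lee_fin invr_ge0 pi_ge0.
have : (pi%:E * dirichlet_integral f < +oo)%E.
  by apply: lte_mul_pinfty h => //; rewrite lee_fin pi_ge0.
by rewrite /dirichlet_integral muleA -EFinM mulfV ?mul1e// gt_eqF// pi_gt0.
Qed.

Lemma dirichlet_cst (c : R[i]) : (fun _ : disc R => c) \in in_dirichlet R.
Proof.
have near_c z : disc R z -> {near z, 'valL_0 (fun _ : disc R => c) =1 (cst c : R[i] -> R[i])}.
  move=> Dz; have := open_nbhs_nbhs (conj open_disc Dz).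
  apply: filterS => w Dw; rewrite /valL_ /= oinv_set_val.
  have wD : w \in disc R by rewrite inE.
  by rewrite insubT.
apply/asboolP; split=> [z /near_c cz|].
  apply: (@near_eq_derivable _ _ _ (cst c)); last exact: derivable_cst.
  by apply: filterS cz => w ->.
apply/dirichlet_fin; rewrite integral0_eq ?ltry// => p Dp.
rewrite derive1E (near_eq_derive _ (near_c _ Dp)) derive_cst.
by rewrite Normc.normc0 expr0n.
Qed.

Lemma in_dirichlet_submod : submod_closed (in_dirichlet R).
Proof.
split=> [|a f g /asboolP[hf /dirichlet_fin If] /asboolP[hg /dirichlet_fin Ig]].
  exact: dirichlet_cst 0.
have hfg : holomorphic_disc (a *: f + g).
  move=> z Dz; rewrite valL_lin; apply: derivableD; last exact: hg.
  by apply: derivableZ; exact: hf.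
apply/asboolP; split=> //; apply/dirichlet_fin.
pose N (h : disc R -> R[i]) (p : mR2) : R :=
  Normc.normc (('valL_0 h)^`()%classic (toC p)) ^+ 2.
pose k := 2 * Normc.normc a ^+ 2.
have k0 : 0 <= k by rewrite mulr_ge0// sqr_ge0.
have N0 h p : (0 <= (N h p)%:E)%E by rewrite lee_fin sqr_ge0.
have mN h : holomorphic_disc h -> measurable_fun (planar_disc R : set mR2) (EFin \o N h).
  by move=> ?; apply/measurable_EFinP; exact: measurable_derive.
have mD := measurable_planar.
have mk (c : R) h : holomorphic_disc h ->
    measurable_fun (planar_disc R : set mR2) (fun p => c%:E * (N h p)%:E)%E.
  by move=> ?; apply: measurable_funeM; exact: mN.
apply: (@le_lt_trans _ _
    (\int[area R]_(p in planar_disc R) (k%:E * (N f p)%:E + 2%:E * (N g p)%:E))%E).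
  apply: ge0_le_integral => //.
  - by move=> p _; exact: N0.
  - exact: mN.
  - by apply: emeasurable_funD; exact: mk.
  move=> p Dp; rewrite -!EFinM -EFinD lee_fin valL_lin derive1E.
  rewrite deriveD; [|by apply: derivableZ; exact: hf|exact: hg].
  rewrite deriveZ; last exact: hf.
  rewrite -!derive1E /k /N.
  set u : R[i] := derive1 ('valL_0 f) _; set v : R[i] := derive1 ('valL_0 g) _.
  rewrite -mulrA -exprMn -Normc.normcM.
  rewrite (_ : a *: u + v = a * u + v) //.
  have := le_normcD (a * u) v.
  have : 0 <= Normc.normc (a * u + v) by case: (a * u + v) => ? ? /=; exact: sqrtr_ge0.
  move: (Normc.normc (a * u)) (Normc.normc v) (Normc.normc _) => s t w w0 wst.
  apply: (@le_trans _ _ ((s + t) ^+ 2)).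
    by rewrite ler_pXn2r// nnegrE// (le_trans w0).
  rewrite -subr_ge0 (_ : _ - _ = (s - t) ^+ 2) ?sqr_ge0//; ring.
rewrite ge0_integralD//; last first.
- exact: mk.
- by move=> p _; rewrite mule_ge0// lee_fin.
- exact: mk.
- by move=> p _; rewrite mule_ge0// lee_fin.
apply: lte_add_pinfty.
  rewrite (@ge0_integralZl_EFin _ _ _ (area R) _ mD _ (fun p _ => N0 f p) (mN f hf) k k0).
  by apply: lte_mul_pinfty If; rewrite ?lee_fin.
rewrite (@ge0_integralZl_EFin _ _ _ (area R) _ mD _ (fun p _ => N0 g p) (mN g hg) 2 (ler0n _ 2)).
by apply: lte_mul_pinfty Ig; rewrite ?lee_fin.
Qed.

End dirichlet_closed.

HB.instance Definition _ (R : realType) :=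
  GRing.isSubmodClosed.Build R[i] (disc R -> R[i]) (in_dirichlet R)
    (in_dirichlet_submod R).

Record dirichlet (R : realType) := Dirichlet {
  dirichlet_fun :> disc R -> R[i];
  dirichlet_funP : dirichlet_fun \in in_dirichlet R }.

HB.instance Definition _ (R : realType) :=
  [isSub for @dirichlet_fun R].
HB.instance Definition _ (R : realType) :=
  [Choice of dirichlet R by <:].
HB.instance Definition _ (R : realType) :=
  [SubChoice_isSubLmodule of dirichlet R by <:].

Definition dirichlet_one (R : realType) : dirichlet R :=
  Dirichlet (dirichlet_cst 1).
Arguments dirichlet_one : clear implicits.

(* Main.v *)
(* A function [f] of finite Dirichlet integral has an image of finite area, so it
   omits two values [l1] and [l2], and [f - l1], [f - l2] vanish nowhere.  For a
   nowhere-vanishing [k], the functional [p |-> Lambda (p k) / Lambda k] on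
   polynomials is nonzero on polynomials without zeros in the disc; looking at the
   roots of [w |-> l ((1 + w p) ^ N)] for large [N], as in the
   Gleason-Kahane-Zelazko theorem, one sees that it is multiplicative, hence an
   evaluation at some point of the disc.  Comparing these points for the constant
   [1], [f - l1] and [f - l2], which are linearly dependent, shows that they all
   coincide with a single [a], whence [Lambda (p f) = p(a) Lambda f] for all [f].
   Finally [f - f(a) = (z - a) q] with [q] in the Dirichlet space, so
   [Lambda f = f(a)].

   That the Dirichlet space is stable under multiplication by [z] and under
   division by [z - a] needs the regularity of complex differentiable functions,
   obtained from Goursat's lemma and Cauchy's formula on rectangles, and the
   square integrability of [f], obtained by integrating [f'] along horizontal
   and vertical chords. *)
Require Import Defs.
From mathcomp Require Import all_boot all_order all_algebra.
From mathcomp Require Import ring lra complex.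
From mathcomp Require Import all_classical all_reals all_analysis.
From mathcomp Require Import measurable_realfun.

Set Implicit Arguments.
Unset Strict Implicit.
Unset Printing Implicit Defensive.

Import Order.TTheory GRing.Theory Num.Theory.
Import numFieldNormedType.Exports.

Local Open Scope classical_set_scope.
Local Open Scope ring_scope.
Local Open Scope complex_scope.

(** The Dirichlet space is not an algebra and [Lambda] is not assumed continuous, so exponentials of
    [w f], on which the classical Gleason-Kahane-Zelazko argument rests, are out of reach.
    Multiplication by polynomials does preserve the space: [(1 + w p) ^ N] replaces the exponential,
    and its image under the functional is a polynomial in [w] whose roots are controlled by a bound
    of [p] on the disc. One omitted value [l1] would only give [Lambda (p f) = l1 p(a0) + (Lambda f
    - l1) p(a1)] with an unknown point [a1]. A second omitted value gives a second such formula, and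
    the independence of evaluations at distinct points makes the two compatible only if [a1 = a0].
    The area of the image is bounded without a change of variables: the disc is cut into dyadic
    squares on which the modulus of [f'] varies by at most 1, and the image of each square lies in a
    box whose area is comparable to the integral of [|f'| ^ 2] plus a constant, the constant being
    harmless on a disc of finite area. *)

Local Notation normc := Normc.normc.
Local Notation Re := complex.Re.
Local Notation Im := complex.Im.

(** * Complex modulus *)

Section modulus.
Variable R : realType.
Implicit Types (x y : R) (z w : R[i]).

Lemma normc_ge0 z : 0 <= normc z.
Proof. by case: z => a b; exact: sqrtr_ge0. Qed.

Lemma normcE z : `|z| = (normc z)%:C.
Proof. by rewrite normc_def; case: z. Qed.

Lemma normc_eq0 z : (normc z == 0) = (z == 0).
Proof. by apply/eqP/eqP => [/Normc.eq0_normc//|->]; rewrite Normc.normc0. Qed.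

Lemma normc_gt0 z : (0 < normc z) = (z != 0).
Proof. by rewrite lt_def normc_ge0 andbT normc_eq0. Qed.

Lemma normcB z w : normc (z - w) = normc (w - z).
Proof. by rewrite -normcN opprB. Qed.

Lemma normcX z n : normc (z ^+ n) = normc z ^+ n.
Proof. by elim: n => [|n IH]; rewrite ?expr0 ?Normc.normc1// !exprS Normc.normcM IH. Qed.

Lemma normc_real x : normc x%:C = `|x|.
Proof. by rewrite /= expr0n addr0 sqrtr_sqr. Qed.

Lemma normc_i : normc ('i : R[i]) = 1.
Proof. by rewrite /= expr0n expr1n add0r sqrtr1. Qed.

Lemma sqr_normcE z : normc z ^+ 2 = Re z ^+ 2 + Im z ^+ 2.
Proof. by case: z => a b /=; rewrite sqr_sqrtr// addr_ge0 ?sqr_ge0. Qed.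

Lemma normc_Re z : `|Re z| <= normc z.
Proof. by have := normc_ge_Re z; rewrite normcE lecR. Qed.

Lemma normc_Im z : `|Im z| <= normc z.
Proof.
rewrite -(@ler_pXn2r _ 2) ?nnegrE ?normc_ge0// sqr_normcE real_normK ?num_real//.
by rewrite lerDr sqr_ge0.
Qed.

Lemma normc_leD z : normc z <= `|Re z| + `|Im z|.
Proof. by case: z => a b; exact: normc_le. Qed.

Lemma ReD z w : Re (z + w) = Re z + Re w. Proof. by case: z; case: w. Qed.
Lemma ImD z w : Im (z + w) = Im z + Im w. Proof. by case: z; case: w. Qed.
Lemma ReN z : Re (- z) = - Re z. Proof. by case: z. Qed.
Lemma ImN z : Im (- z) = - Im z. Proof. by case: z. Qed.
Lemma ReM z w : Re (z * w) = Re z * Re w - Im z * Im w.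
Proof. by case: z; case: w. Qed.
Lemma ImM z w : Im (z * w) = Re z * Im w + Im z * Re w.
Proof. by case: z; case: w. Qed.

Lemma complexP z w : Re z = Re w -> Im z = Im w -> z = w.
Proof. by case: z; case: w => a b c d /= -> ->. Qed.

Lemma discE z : disc R z <-> normc z < 1.
Proof. by rewrite /disc /= normcE -[1]/(1%:C) ltcR. Qed.

Lemma near_normcP z (P : R[i] -> Prop) :
  (\forall w \near z, P w) <->
  exists2 d : R, 0 < d & forall w, normc (w - z) < d -> P w.
Proof.
split=> [/nbhs_complexP[d d0 dP]|[d d0 dP]].
  by exists d => // w wd; apply: dP; rewrite normcB.
apply/nbhs_ballP; exists d%:C; first by rewrite /= -[0]/(0%:C) ltcR.
by move=> w; rewrite /ball /= normcE ltcR => wd; apply: dP; rewrite normcB.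
Qed.

Lemma cts_normcP (F : R[i] -> R[i]) z : {for z, continuous F} <->
  forall e : R, 0 < e ->
    exists2 d : R, 0 < d & forall w, normc (w - z) < d -> normc (F w - F z) < e.
Proof.
split=> [cF e e0|H A /nbhs_complexP[e e0 eA]].
  have /cF : nbhs (F z) [set w | normc (w - F z) < e] by apply/near_normcP; exists e.
  by move=> /near_normcP.
apply/near_normcP; have [d d0 dH] := H e e0.
by exists d => // w /dH; rewrite normcB; exact: eA.
Qed.

(** The multiplied-out form has no quotient, so [w = z] requires no exception and real moduli can be
    estimated directly. *)
Lemma is_derive_normcP (F : R[i] -> R[i]) z l : is_derive z 1 F l <->
  forall e : R, 0 < e -> exists2 d : R, 0 < d & forall w, normc (w - z) < d ->
     normc (F w - F z - l * (w - z)) <= e * normc (w - z).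
Proof.
have E : is_derive z 1 F l <->
    (fun h : R[i] => h^-1 *: (F (h *: 1 + z) - F z)) @ (0 : R[i])^' --> (l : R[i]).
  split=> [[dF <-]|H]; first exact: dF.
  split; first by apply/cvg_ex; exists l.
  exact: cvg_lim H.
apply: (iff_trans E); split=> [H e e0|H A /nbhs_complexP[e e0 eA]].
  have /H : nbhs (l : R[i]) [set w | normc (w - l) < e] by apply/near_normcP; exists e.
  move=> /near_normcP[d d0 dP]; exists d => // w wd.
  have [->|wz] := eqVneq w z; first by rewrite !subrr mulr0 subrr Normc.normc0 mulr0.
  have wz0 : w - z != 0 by rewrite subr_eq0.
  have /(_ _ wz0)/= := dP (w - z); rewrite subr0 => /(_ wd)/ltW.
  rewrite -[(w - z) *: 1]/((w - z) * 1) mulr1 subrK -[_ *: _]/(_ * _) => h.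
  have -> : F w - F z - l * (w - z) = ((w - z)^-1 * (F w - F z) - l) * (w - z).
    by rewrite mulrBl mulrAC mulVf ?mul1r.
  by rewrite Normc.normcM ler_wpM2r ?normc_ge0.
(* The non-strict estimate at [e / 2] yields the strict one at [e]. *)
have e20 : 0 < e / 2 by rewrite divr_gt0.
have [d d0 dP] := H (e / 2) e20.
apply/near_normcP; exists d => // h; rewrite subr0 => hd h0; apply: eA.
have := dP (h + z); rewrite addrK => /(_ hd) hP.
rewrite normcB -[h *: 1]/(h * 1) mulr1 -[_ *: _]/(_ * _).
have -> : h^-1 * (F (h + z) - F z) - l = (F (h + z) - F z - l * h) * h^-1.
  by rewrite mulrBl mulfK// mulrC.
rewrite Normc.normcM Normc.normcV ltr_pdivrMr ?normc_gt0//.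
apply: (le_lt_trans hP); rewrite ltr_pM2r ?normc_gt0//.
by rewrite ltr_pdivrMr// ltr_pMr// ltr1n.
Qed.

Lemma derivable_cts (F : R[i] -> R[i]) z : derivable F z 1 -> {for z, continuous F}.
Proof. by move=> dF; apply: differentiable_continuous; apply/derivable1_diffP. Qed.

Lemma cts_ReIm (T : topologicalType) (u : T -> R[i]) (t : T) :
  {for t, continuous u} ->
  {for t, continuous (fun s => Re (u s))} /\ {for t, continuous (fun s => Im (u s))}.
Proof.
move=> cu; split.
  exact: (@continuous_comp _ _ _ u (@complex.Re R) t cu (@cts_Re R _)).
exact: (@continuous_comp _ _ _ u (@complex.Im R) t cu (@cts_Im R _)).
Qed.

End modulus.

(** * Integration of complex functions over real segments *)

Section complex_integral.
Variable R : realType.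
Local Notation mu := (@lebesgue_measure R).
Implicit Types (a b m : R) (u v : R -> R[i]).

Definition cint a b u : R[i] :=
  (\int[mu]_(t in `[a, b]) Re (u t))%R +i* (\int[mu]_(t in `[a, b]) Im (u t))%R.

(** Continuity is two-sided even at the end points: the integrands come from functions continuous at
    each point of a contour in the plane, so it passes directly through compositions. *)
Definition ctsab (T : topologicalType) a b (u : R -> T) :=
  forall t, a <= t <= b -> {for t, continuous u}.

Lemma ctsab_integrable a b (u : R -> R) :
  ctsab a b u -> mu.-integrable `[a, b] (EFin \o u).
Proof.
move=> cu; apply: continuous_compact_integrable; first exact: segment_compact.
apply: continuous_in_subspaceT => t; rewrite inE /= in_itv /= => tab.
exact: cu.
Qed.

Lemma ctsab_Re a b u : ctsab a b u -> ctsab a b (fun t => Re (u t)).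
Proof. by move=> cu t /cu /cts_ReIm[]. Qed.

Lemma ctsab_Im a b u : ctsab a b u -> ctsab a b (fun t => Im (u t)).
Proof. by move=> cu t /cu /cts_ReIm[]. Qed.

Lemma mu_itvcc a b : a <= b -> mu `[a, b] = (b - a)%:E.
Proof.
rewrite lebesgue_measure_itv /= lte_fin le_eqVlt => /predU1P[->|->].
  by rewrite ltxx subrr.
by rewrite -EFinD.
Qed.

Lemma length_itvcc a b : a <= b -> fine (mu `[a, b]) = b - a.
Proof. by move=> ab; rewrite mu_itvcc. Qed.

Lemma cint_cst a b (c : R[i]) : a <= b -> cint a b (fun=> c) = (b - a)%:C * c.
Proof.
move=> ab; rewrite /cint !Rintegral_cst//; try exact: measurable_itv.
rewrite length_itvcc//; case: c => p q /=; apply/complexP => /=; ring.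
Qed.

Lemma cintD a b u v : ctsab a b u -> ctsab a b v ->
  cint a b (fun t => u t + v t) = cint a b u + cint a b v.
Proof.
move=> cu cv; rewrite /cint.
under eq_Rintegral do rewrite ReD.
rewrite RintegralD//; try exact/ctsab_integrable/ctsab_Re.
under [X in _ +i* X]eq_Rintegral do rewrite ImD.
by rewrite RintegralD//; exact/ctsab_integrable/ctsab_Im.
Qed.

Lemma cintZ a b (c : R[i]) u : ctsab a b u ->
  cint a b (fun t => c * u t) = c * cint a b u.
Proof.
move=> cu; rewrite /cint.
have iR := ctsab_integrable (ctsab_Re cu).
have iI := ctsab_integrable (ctsab_Im cu).
have mI : measurable `[a, b]%classic by exact: measurable_itv.
have iZ (k : R) (w : R -> R) : mu.-integrable `[a, b] (EFin \o w) ->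
    mu.-integrable `[a, b] (EFin \o (fun t => k * w t)).
  move=> iw; rewrite (_ : EFin \o _ = (fun t => k%:E * (EFin \o w) t)%E).
    exact: integrableZl.
  by apply/funext => t; rewrite /= EFinM.
apply/complexP => /=.
  under eq_Rintegral do rewrite ReM.
  rewrite RintegralB ?RintegralZl//; try exact: iZ.
  by case: c => p q.
under eq_Rintegral do rewrite ImM.
rewrite RintegralD ?RintegralZl//; try exact: iZ.
by case: c => p q.
Qed.

Lemma cint_split a m b u : a <= m -> m <= b -> ctsab a b u ->
  cint a b u = cint a m u + cint m b u.
Proof.
move=> am mb cu.
have H (w : R -> R) : ctsab a b w ->
    (\int[mu]_(t in `[a, b]) w t = \int[mu]_(t in `[a, m]) w t + \int[mu]_(t in `[m, b]) w t)%R.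
  move=> cw; apply/eqP; rewrite addrC -subr_eq; apply/eqP.
  rewrite Rintegral_itvB ?bnd_simp//; last exact: ctsab_integrable.
  rewrite Rintegral_itv_obnd_cbnd//.
  apply: (integrableS _ _ _ (ctsab_integrable cw)) => //.
  by apply: subset_itv; rewrite bnd_simp.
by rewrite /cint (H _ (ctsab_Re cu)) (H _ (ctsab_Im cu)).
Qed.

Lemma Rintegral_bound a b (w : R -> R) (M : R) : a <= b -> ctsab a b w ->
  (forall t, a <= t <= b -> `|w t| <= M) ->
  `|(\int[mu]_(t in `[a, b]) w t)%R| <= M * (b - a).
Proof.
move=> ab cw wM.
apply: le_trans; first by apply: le_normr_Rintegral => //; exact: ctsab_integrable.
rewrite -length_itvcc// -Rintegral_cst//; apply: le_Rintegral => //.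
- apply: ctsab_integrable => t /cw ct.
  exact: (@continuous_comp _ _ _ w (fun x => `|x|) t ct (@norm_continuous _ _ _)).
- by apply: ctsab_integrable => t _; exact: cvg_cst.
Qed.

(** The factor 2 comes from bounding the real and imaginary parts separately. *)
Lemma cint_bound a b u (M : R) : a <= b -> ctsab a b u ->
  (forall t, a <= t <= b -> normc (u t) <= M) ->
  normc (cint a b u) <= 2 * M * (b - a).
Proof.
move=> ab cu uM; apply: (le_trans (normc_leD _)).
rewrite -mulrA mulr_natl mulr2n; apply: lerD.
  apply: Rintegral_bound => //; first exact: ctsab_Re.
  by move=> t /uM; apply: le_trans; exact: normc_Re.
apply: Rintegral_bound => //; first exact: ctsab_Im.
by move=> t /uM; apply: le_trans; exact: normc_Im.
Qed.

Lemma cint_Im_ge a b u (k : R) : a <= b -> ctsab a b u ->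
  (forall t, a <= t <= b -> k <= Im (u t)) -> k * (b - a) <= Im (cint a b u).
Proof.
move=> ab cu uk; rewrite /= -length_itvcc// -Rintegral_cst//.
apply: le_Rintegral => //.
- by apply: ctsab_integrable => t _; exact: cvg_cst.
- exact/ctsab_integrable/ctsab_Im.
Qed.

Lemma eq_cint a b u v : (forall t, a <= t <= b -> u t = v t) ->
  cint a b u = cint a b v.
Proof.
move=> uv; rewrite /cint; congr Complex; apply: eq_Rintegral => t;
by rewrite inE /= in_itv /= => /uv ->.
Qed.

End complex_integral.

(** * Contour integrals and the Cauchy theory *)

Section rectangle.
Variable R : realType.
Implicit Types (a b c d m t : R) (F G : R[i] -> R[i]).

(** Contour integral along the boundary, counterclockwise: [dz] is [dt] on the horizontal sides and
    ['i dt] on the vertical ones. *)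
Definition rint F a b c d : R[i] :=
  cint a b (fun t => F (t +i* c)) - cint a b (fun t => F (t +i* d)) +
  'i * (cint c d (fun t => F (b +i* t)) - cint c d (fun t => F (a +i* t))).

Definition rect a b c d : set R[i] :=
  [set z | a <= Re z <= b /\ c <= Im z <= d].

Definition boundary a b c d : set R[i] :=
  [set z | rect a b c d z /\
    (Re z == a) || (Re z == b) || (Im z == c) || (Im z == d)].

Definition cts_on (A : set R[i]) F := forall z, A z -> {for z, continuous F}.

Lemma cts_comp (T S : topologicalType) (u : T -> R[i]) (F : R[i] -> S) (t : T) :
  {for t, continuous u} -> {for (u t), continuous F} ->
  {for t, continuous (fun s => F (u s))}.
Proof. by move=> cu cF A /cF /cu. Qed.

Lemma cts_hline F c t : {for (t +i* c), continuous F} ->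
  {for t, continuous (fun s => F (s +i* c))}.
Proof.
move=> cF A /cF /nbhs_complexP[r r0 rA]; apply/nbhs_ballP; exists r => // s.
rewrite /ball /= => ts; apply: rA; apply: le_lt_trans (normc_leD _) _.
by rewrite /= subrr normr0 addr0.
Qed.

Lemma cts_vline F c t : {for (c +i* t), continuous F} ->
  {for t, continuous (fun s => F (c +i* s))}.
Proof.
move=> cF A /cF /nbhs_complexP[r r0 rA]; apply/nbhs_ballP; exists r => // s.
rewrite /ball /= => ts; apply: rA; apply: le_lt_trans (normc_leD _) _.
by rewrite /= subrr normr0 add0r.
Qed.

Section sides.
Variables (a b c d : R).
Hypotheses (ab : a <= b) (cd : c <= d).

Lemma boundary_sides t :
  (a <= t <= b -> boundary a b c d (t +i* c) /\ boundary a b c d (t +i* d)) /\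
  (c <= t <= d -> boundary a b c d (a +i* t) /\ boundary a b c d (b +i* t)).
Proof.
by split=> tab; split; split; rewrite /rect /= ?lexx ?tab ?ab ?cd ?eqxx ?orbT.
Qed.

Lemma cts_on_sides F : cts_on (boundary a b c d) F ->
  [/\ ctsab a b (fun t => F (t +i* c)), ctsab a b (fun t => F (t +i* d)),
      ctsab c d (fun t => F (a +i* t)) & ctsab c d (fun t => F (b +i* t))].
Proof.
move=> cF; split=> t tab.
- by apply: cts_hline; apply: cF; have [/(_ tab)[]] := boundary_sides t.
- by apply: cts_hline; apply: cF; have [/(_ tab)[]] := boundary_sides t.
- by apply: cts_vline; apply: cF; have [_ /(_ tab)[]] := boundary_sides t.
- by apply: cts_vline; apply: cF; have [_ /(_ tab)[]] := boundary_sides t.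
Qed.

Lemma rintD F G : cts_on (boundary a b c d) F -> cts_on (boundary a b c d) G ->
  rint (fun z => F z + G z) a b c d = rint F a b c d + rint G a b c d.
Proof.
move=> /cts_on_sides[? ? ? ?] /cts_on_sides[? ? ? ?].
rewrite /rint !cintD//; ring.
Qed.

Lemma rintZ (k : R[i]) F : cts_on (boundary a b c d) F ->
  rint (fun z => k * F z) a b c d = k * rint F a b c d.
Proof.
move=> /cts_on_sides[? ? ? ?].
rewrite /rint !cintZ//; ring.
Qed.

(** The constant 4 is the 2 of [cint_bound] times the two sides in each direction. *)
Lemma rint_bound F M : cts_on (boundary a b c d) F ->
  (forall z, boundary a b c d z -> normc (F z) <= M) ->
  normc (rint F a b c d) <= 4 * M * ((b - a) + (d - c)).
Proof.
move=> /cts_on_sides[? ? ? ?] FM.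
have B1 : normc (cint a b (fun t => F (t +i* c))) <= 2 * M * (b - a).
  by apply: cint_bound => // t tab; apply: FM; have [/(_ tab)[]] := boundary_sides t.
have B2 : normc (cint a b (fun t => F (t +i* d))) <= 2 * M * (b - a).
  by apply: cint_bound => // t tab; apply: FM; have [/(_ tab)[]] := boundary_sides t.
have B3 : normc (cint c d (fun t => F (a +i* t))) <= 2 * M * (d - c).
  by apply: cint_bound => // t tab; apply: FM; have [_ /(_ tab)[]] := boundary_sides t.
have B4 : normc (cint c d (fun t => F (b +i* t))) <= 2 * M * (d - c).
  by apply: cint_bound => // t tab; apply: FM; have [_ /(_ tab)[]] := boundary_sides t.
have D2 (u v : R[i]) : normc (u - v) <= normc u + normc v.
  by rewrite -(normcN v); exact: le_normcD.
apply: (le_trans (le_normcD _ _)); rewrite Normc.normcM normc_i mul1r.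
apply: (le_trans (lerD (D2 _ _) (D2 _ _))).
apply: (le_trans (lerD (lerD B1 B2) (lerD B4 B3))).
by lra.
Qed.

Lemma eq_rint F G : (forall z, boundary a b c d z -> F z = G z) ->
  rint F a b c d = rint G a b c d.
Proof.
move=> FG; rewrite /rint; congr (_ - _ + 'i * (_ - _)); apply: eq_cint => t tab;
 apply: FG; have [H1 H2] := boundary_sides t.
- by have [] := H1 tab.
- by have [] := H1 tab.
- by have [] := H2 tab.
- by have [] := H2 tab.
Qed.

Lemma cts_affine (k l : R[i]) z : {for z, continuous (fun w : R[i] => k * w + l)}.
Proof.
apply/cts_normcP => e e0; exists (e / (normc k + 1)).
  by rewrite divr_gt0// ltr_wpDl// normc_ge0.
move=> w; rewrite ltr_pdivlMr ?ltr_wpDl ?normc_ge0// => h.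
rewrite opprD addrACA subrr addr0 -mulrBr Normc.normcM; apply: le_lt_trans h.
by rewrite mulrC ler_wpM2l ?normc_ge0// lerDl.
Qed.

Lemma cts_mull (k : R[i]) z : {for z, continuous (fun w : R[i] => k * w)}.
Proof.
apply/cts_normcP => e e0; have /cts_normcP/(_ e e0)[r r0 rP] := @cts_affine k 0 z.
by exists r => // w /rP; rewrite !addr0.
Qed.

(** An affine map differs between opposite sides by a constant, so only integrals of constants
    remain, and the two directions cancel. No primitive is involved. *)
Lemma rint_affine (k l : R[i]) : rint (fun z => k * z + l) a b c d = 0.
Proof.
have E1 (p q : R[i]) t : p * (t +i* c) + q + -1 * (p * (t +i* d) + q) = p * 'i * (c - d)%:C.
  by case: p q => [? ?] [? ?]; apply/complexP => /=; ring.
have E2 (p q : R[i]) t : p * (b +i* t) + q + -1 * (p * (a +i* t) + q) = p * (b - a)%:C.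
  by case: p q => [? ?] [? ?]; apply/complexP => /=; ring.
have E3 (p : R[i]) : (b - a)%:C * (p * 'i * (c - d)%:C) + 'i * ((d - c)%:C * (p * (b - a)%:C)) = 0.
  by case: p => [? ?]; apply/complexP => /=; ring.
have cA A : cts_on A (fun w : R[i] => k * w + l) by move=> z _; exact: cts_affine.
have [? ? ? ?] := cts_on_sides (cA _).
have sub (u v : R -> R[i]) p q : ctsab p q u -> ctsab p q v ->
    cint p q u - cint p q v = cint p q (fun t => u t + (-1) * v t).
  move=> cu cv.
  have cv' : ctsab p q (fun t => -1 * v t).
    move=> t /cv cvt; apply: (cts_comp cvt (F := fun w => -1 * w)).
    exact: cts_mull.
  by rewrite (cintD cu cv') (cintZ _ cv) mulN1r.
rewrite /rint !sub//.
rewrite (@eq_cint _ a b _ (fun=> k * 'i * (c - d)%:C)) => [|t _]; last exact: E1.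
rewrite (@eq_cint _ c d _ (fun=> k * (b - a)%:C)) => [|t _]; last exact: E2.
by rewrite !cint_cst// E3.
Qed.

End sides.

Lemma rint_splitx F a m b c d : a <= m -> m <= b -> c <= d ->
  cts_on (boundary a b c d) F ->
  rint F a b c d = rint F a m c d + rint F m b c d.
Proof.
move=> am mb cd /(cts_on_sides (le_trans am mb) cd)[? ? ? ?].
rewrite /rint !(cint_split am mb)//; ring.
Qed.

Lemma rint_splity F a b c m d : a <= b -> c <= m -> m <= d ->
  cts_on (boundary a b c d) F ->
  rint F a b c d = rint F a b c m + rint F a b m d.
Proof.
move=> ab cm md /(cts_on_sides ab (le_trans cm md))[? ? ? ?].
rewrite /rint !(cint_split cm md)//; ring.
Qed.

End rectangle.

(** * Goursat's lemma by bisection *)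

Section goursat.
Variable R : realType.
Implicit Types (a b c d : R) (F : R[i] -> R[i]).

Lemma nested_intervals (l r : nat -> R) :
  (forall n, l n <= l n.+1) -> (forall n, r n.+1 <= r n) ->
  (forall n, l n <= r n) -> exists p, forall n, l n <= p <= r n.
Proof.
move=> lS rS lr.
have lm n k : l n <= l (n + k)%N.
  by elim: k => [|k IH]; rewrite ?addn0// addnS (le_trans IH).
have rm n k : r (n + k)%N <= r n.
  by elim: k => [|k IH]; rewrite ?addn0// addnS (le_trans (rS _)).
have lr' n k : l n <= r k.
  by apply: (le_trans (lm n k)); apply: (le_trans (lr _)); rewrite addnC.
exists (sup (range l)) => n; apply/andP; split.
  apply: ub_le_sup; last by exists n.
  by exists (r 0%N) => _ [k _ <-].
by apply: ge_sup; [exists (l 0%N), 0%N|move=> _ [k _ <-]].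
Qed.

(** A property inherited by some quarter selects nested rectangles shrinking to a point; that point
    lies in all of them. *)
Lemma rect_bisection (P : R -> R -> R -> R -> Prop) a b c d :
  (forall a b c d, P a b c d -> a <= b /\ c <= d) ->
  (forall a b c d, P a b c d ->
     let m := (a + b) / 2 in let n := (c + d) / 2 in
     [\/ P a m c n, P m b c n, P a m n d | P m b n d]) ->
  P a b c d ->
  exists p : R[i], forall e, 0 < e -> exists a' b' c' d',
    [/\ P a' b' c' d', rect a' b' c' d' p & (b' - a') + (d' - c') < e].
Proof.
move=> Ple Pstep P0.
pose Q := (R * R * R * R)%type.
pose PQ (q : Q) := P q.1.1.1 q.1.1.2 q.1.2 q.2.
pose rel (q q' : Q) := PQ q -> [/\ PQ q', q.1.1.1 <= q'.1.1.1, q'.1.1.2 <= q.1.1.2,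
  q.1.2 <= q'.1.2 & q'.2 <= q.2] /\
   (q'.1.1.2 - q'.1.1.1 = (q.1.1.2 - q.1.1.1) / 2 /\ q'.2 - q'.1.2 = (q.2 - q.1.2) / 2).
have [f fP] : {f : Q -> Q & forall q, rel q (f q)}.
  apply: choice => -[[[x y] z] w]; rewrite /rel /PQ /=.
  (* Outside [P] the relation [rel] holds vacuously, which makes the choice function total. *)
  have [Pq|nP] := pselect (P x y z w); last by exists (x, y, z, w).
  have [xy zw] := Ple _ _ _ _ Pq.
  have [H|H|H|H] := Pstep _ _ _ _ Pq.
  - exists (x, (x + y) / 2, z, (z + w) / 2) => _ /=.
    by split; [split => //; lra|split; lra].
  - exists ((x + y) / 2, y, z, (z + w) / 2) => _ /=.
    by split; [split => //; lra|split; lra].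
  - exists (x, (x + y) / 2, (z + w) / 2, w) => _ /=.
    by split; [split => //; lra|split; lra].
  - exists ((x + y) / 2, y, (z + w) / 2, w) => _ /=.
    by split; [split => //; lra|split; lra].
pose q n := iter n f (a, b, c, d).
have Pq n : PQ (q n).
  by elim: n => [|n IH] //; have [[]] := fP _ IH.
have [px pxP] : exists p, forall n, (q n).1.1.1 <= p <= (q n).1.1.2.
  apply: nested_intervals => n.
  - by have [[]] := fP _ (Pq n).
  - by have [[]] := fP _ (Pq n).
  - by have [] := Ple _ _ _ _ (Pq n).
have [py pyP] : exists p, forall n, (q n).1.2 <= p <= (q n).2.
  apply: nested_intervals => n.
  - by have [[]] := fP _ (Pq n).
  - by have [[]] := fP _ (Pq n).
  - by have [] := Ple _ _ _ _ (Pq n).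
exists (px +i* py) => e e0.
have size n : ((q n).1.1.2 - (q n).1.1.1) + ((q n).2 - (q n).1.2) =
    ((b - a) + (d - c)) / 2 ^+ n.
  elim: n => [|n IH]; first by rewrite expr0 divr1.
  have [_ [h1 h2]] := fP _ (Pq n).
  rewrite /q iterS -/(q n) h1 h2 -mulrDl IH exprSr invfM mulrA//.
have [ab cd] := Ple _ _ _ _ P0.
pose L := (b - a) + (d - c).
have L0 : 0 <= L by rewrite /L; lra.
(* Since [n < 2 ^ n], any [n] above [L / e] is enough. *)
have [n nP] : exists n, L / 2 ^+ n < e.
  have Le : 0 <= L / e by rewrite divr_ge0// ltW.
  exists (Num.truncn (L / e)).+1; rewrite ltr_pdivrMr ?exprn_gt0// mulrC -ltr_pdivrMr//.
  have /andP[_ h] := truncn_itv Le.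
  apply: (lt_le_trans h); rewrite -natrX ler_nat; exact/ltnW/ltn_expl.
exists (q n).1.1.1, (q n).1.1.2, (q n).1.2, (q n).2; split.
- exact: Pq.
- by split => /=.
- by rewrite size.
Qed.

Lemma rect_sub a b c d a' b' c' d' : a <= a' -> b' <= b -> c <= c' -> d' <= d ->
  rect a' b' c' d' `<=` rect a b c d.
Proof.
move=> aa bb cc dd z [/andP[z1 z2] /andP[z3 z4]]; split; apply/andP; split.
- exact: le_trans aa z1.
- exact: le_trans z2 bb.
- exact: le_trans cc z3.
- exact: le_trans z4 dd.
Qed.

Theorem goursat F a b c d : a < b -> c < d ->
  (forall z, rect a b c d z -> derivable F z 1) -> rint F a b c d = 0.
Proof.
move=> ab cd dF; apply/eqP; rewrite -normc_eq0; apply/eqP.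
apply: contrapT => /eqP N0.
have {N0} : 0 < normc (rint F a b c d) by rewrite lt_def N0 normc_ge0.
set N := normc _ => N0.
pose S a b c d : R := (b - a) ^+ 2 + (d - c) ^+ 2.
have S0 x y z w : 0 <= S x y z w by rewrite addr_ge0// sqr_ge0.
(* The lower bound [k * S] on the contour integral is quadratic in the size of
   the rectangle, hence inherited by one of its four quarters. *)
pose k := N / (S a b c d + 1).
have k0 : 0 < k by rewrite divr_gt0// ltr_wpDl.
pose P x y z w := [/\ x < y, z < w, rect x y z w `<=` rect a b c d &
  k * S x y z w <= normc (rint F x y z w)].
have cF x y z w : rect x y z w `<=` rect a b c d -> cts_on (boundary x y z w) F.
  by move=> sub p [/sub/dF dp _]; exact: derivable_cts.
have step x y z w : P x y z w -> let m := (x + y) / 2 in let n := (z + w) / 2 in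
     [\/ P x m z n, P m y z n, P x m n w | P m y n w].
  move=> [xy zw sub kS] m n.
  have [xm [my [zn nw]]] : x < m /\ m < y /\ z < n /\ n < w.
    by rewrite /m /n; split; [lra|split; [lra|split; lra]].
  have c1 : cts_on (boundary x y z w) F by exact: cF.
  have c2 : cts_on (boundary x m z w) F.
    by apply: cF; apply: subset_trans sub; apply: rect_sub => //; exact: ltW.
  have c3 : cts_on (boundary m y z w) F.
    by apply: cF; apply: subset_trans sub; apply: rect_sub => //; exact: ltW.
  have E : rint F x y z w = (rint F x m z n + rint F x m n w) +
     (rint F m y z n + rint F m y n w).
    by rewrite (rint_splitx (ltW xm) (ltW my) (ltW zw) c1)
       (rint_splity (ltW xm) (ltW zn) (ltW nw) c2)
       (rint_splity (ltW my) (ltW zn) (ltW nw) c3).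
  have E4 : normc (rint F x y z w) <=
      (normc (rint F x m z n) + normc (rint F x m n w)) +
      (normc (rint F m y z n) + normc (rint F m y n w)).
    rewrite E; apply: (le_trans (le_normcD _ _)); apply: lerD; exact: le_normcD.
  have Sm : [/\ S x m z n = S x y z w / 4, S x m n w = S x y z w / 4,
      S m y z n = S x y z w / 4 & S m y n w = S x y z w / 4].
    by rewrite /S /m /n; split; field.
  case: Sm => s1 s2 s3 s4.
  have [h1|h1] := leP (k * S x m z n) (normc (rint F x m z n)).
    by apply: Or41; split => //; apply: subset_trans sub; apply: rect_sub => //; exact: ltW.
  have [h2|h2] := leP (k * S x m n w) (normc (rint F x m n w)).
    by apply: Or43; split => //; apply: subset_trans sub; apply: rect_sub => //; exact: ltW.
  have [h3|h3] := leP (k * S m y z n) (normc (rint F m y z n)).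
    by apply: Or42; split => //; apply: subset_trans sub; apply: rect_sub => //; exact: ltW.
  have [h4|h4] := leP (k * S m y n w) (normc (rint F m y n w)).
    by apply: Or44; split => //; apply: subset_trans sub; apply: rect_sub => //; exact: ltW.
  rewrite s1 in h1; rewrite s2 in h2; rewrite s3 in h3; rewrite s4 in h4.
  by exfalso; lra.
have P0 : P a b c d.
  split => //; rewrite -/N /k mulrAC ler_pdivrMr ?ltr_wpDl//.
  by rewrite ler_pM2l// lerDl.
have [x y z w [xy zw _ _]|p pP] := rect_bisection _ step P0.
  by rewrite !ltW.
have abcdp : rect a b c d p.
  have [x [y [z [w [[_ _ sub _] rp _]]]]] := pP 1 ltr01.
  exact: sub.
(* With [L] the sum of the two side lengths, [k / 16] gives the upper bound [k * L ^ 2 / 4]. As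
   [L ^ 2 <= 2 * S], this is at most [k * S / 2], against the lower bound [k * S]. *)
have /is_derive_normcP/(_ (k / 16)) := derivableP (dF p abcdp).
case; first by rewrite divr_gt0.
move=> e e0; set l := derive _ _ _ => eP.
have [x [y [z [w [[xy zw sub kS] [/andP[px1 px2] /andP[py1 py2]] small]]]]] := pP e e0.
(* Adding [A] subtracts the first-order Taylor polynomial of [F] at [p]; being affine, it leaves the
   contour integral unchanged. *)
pose A (q : R[i]) := (- l) * q + (l * p - F p).
have L0 : 0 <= (y - x) + (w - z) by lra.
have E : rint F x y z w = rint (fun q => F q + A q) x y z w.
  rewrite rintD ?rint_affine ?addr0// ?ltW//; first exact: cF.
  by move=> q _; exact: cts_affine.
have near q : rect x y z w q -> normc (q - p) <= (y - x) + (w - z).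
  move=> [/andP[q1 q2] /andP[q3 q4]]; apply: (le_trans (normc_leD _)).
  rewrite ReD ReN ImD ImN.
  by apply: lerD; rewrite ler_norml; apply/andP; split; lra.
have : normc (rint F x y z w) <= 4 * (k / 16 * ((y - x) + (w - z))) * ((y - x) + (w - z)).
  rewrite E; apply: rint_bound; try exact: ltW.
    move=> q Bq; apply: continuousD; first by apply: (cF _ _ _ _ sub).
    exact: cts_affine.
  move=> q [rq _]; have nq := near q rq.
  have := eP q (le_lt_trans nq small).
  rewrite (_ : F q - F p - l * (q - p) = F q + A q); last by rewrite /A; ring.
  move=> h; apply: (le_trans h); rewrite ler_pM2l//.
  by rewrite divr_gt0.
have kS' : k * S x y z w > 0 by rewrite mulr_gt0// /S ltr_wpDr ?sqr_ge0// exprn_gt0// subr_gt0.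
have : ((y - x) + (w - z)) ^+ 2 <= 2 * S x y z w.
  rewrite -subr_ge0 (_ : _ - _ = ((y - x) - (w - z)) ^+ 2) ?sqr_ge0//.
  rewrite /S; ring.
move=> h1 h2; have := le_trans kS h2.
rewrite (_ : 4 * (k / 16 * ((y - x) + (w - z))) * ((y - x) + (w - z)) =
  k * ((y - x) + (w - z)) ^+ 2 / 4); last by field.
have : k * ((y - x) + (w - z)) ^+ 2 <= k * (2 * S x y z w) by rewrite ler_pM2l.
lra.
Qed.

End goursat.

(** * Removable singularities and Cauchy's formula *)

Section cauchy.
Variable R : realType.
Implicit Types (a b c d s : R) (p q z : R[i]) (F G : R[i] -> R[i]).

Lemma rect_interior_ball a b c d p : a < Re p < b -> c < Im p < d ->
  exists2 r : R, 0 < r & [/\ a < Re p - r, Re p + r < b, c < Im p - r & Im p + r < d].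
Proof.
move=> /andP[ap pb] /andP[cp pd].
exists (Num.min (Num.min (Re p - a) (b - Re p)) (Num.min (Im p - c) (d - Im p)) / 2).
  by rewrite divr_gt0// !lt_min !subr_gt0 ap pb cp pd.
set m := Num.min _ _.
have /andP[] : (m <= Num.min (Re p - a) (b - Re p)) && (m <= Num.min (Im p - c) (d - Im p)).
  by rewrite -le_min.
rewrite !le_min => /andP[m1 m2] /andP[m3 m4].
by split; lra.
Qed.

(** Four rectangles around a small square centred at [p] contribute 0 by [goursat]. The square of
    half-side [e] contributes at most [4 * M * (2 * e + 2 * e)], which tends to 0 with [e]. *)
Lemma goursat_puncture G a b c d p (M r : R) :
  a < Re p < b -> c < Im p < d ->
  (forall z, rect a b c d z -> z != p -> derivable G z 1) ->
  0 < r -> (forall z, 0 < normc (z - p) < r -> normc (G z) <= M) ->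
  rint G a b c d = 0.
Proof.
move=> pab pcd dG r0 GM.
have [r1 r10 [ra rb rc rd]] := rect_interior_ball pab pcd.
have M0 : 0 <= M.
  apply: le_trans (GM (p + (r / 2)%:C) _); first exact: normc_ge0.
  by rewrite addrAC subrr add0r normc_real gtr0_norm ?divr_gt0//= ltr_pdivrMr// ltr_pMr// ltr1n.
have small e : 0 < e -> 2 * e < r -> e < r1 -> normc (rint G a b c d) <= 16 * M * e.
  move=> e0 er er1.
  set x := Re p - e; set x' := Re p + e; set y := Im p - e; set y' := Im p + e.
  have [ax xx' x'b] : [/\ a < x, x < x' & x' < b] by rewrite /x /x'; split; lra.
  have [cy yy' y'd] : [/\ c < y, y < y' & y' < d] by rewrite /y /y'; split; lra.
  have cG a' b' c' d' : a <= a' -> b' <= b -> c <= c' -> d' <= d ->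
     ~ boundary a' b' c' d' p -> cts_on (boundary a' b' c' d') G.
    move=> aa bb cc dd np z Bz; apply: derivable_cts; apply: dG.
      by case: Bz => /(rect_sub aa bb cc dd).
    by apply/eqP => zp; apply: np; rewrite -zp.
  have G0 a' b' c' d' : a <= a' -> b' <= b -> c <= c' -> d' <= d -> a' < b' -> c' < d' ->
     ~ rect a' b' c' d' p -> rint G a' b' c' d' = 0.
    move=> aa bb cc dd ab cd np; apply: goursat => // z rz; apply: dG.
      exact: rect_sub rz.
    by apply/eqP => zp; apply: np; rewrite -zp.
  have nB a' b' c' d' : a' < Re p -> Re p < b' -> c' < Im p -> Im p < d' ->
      ~ boundary a' b' c' d' p.
    by move=> h1 h2 h3 h4 [_] /orP[/orP[/orP[]|]|] /eqP; lra.
  have [px px' py py'] : [/\ x < Re p, Re p < x', y < Im p & Im p < y'].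
    by rewrite /x /x' /y /y'; split; lra.
  have lpx : a < Re p by lra.
  have lpx' : Re p < b by lra.
  have lpy : c < Im p by lra.
  have lpy' : Im p < d by lra.
  have hax := ltW ax; have hxx := ltW xx'; have hxb := ltW x'b.
  have hcy := ltW cy; have hyy := ltW yy'; have hyd := ltW y'd.
  have [xb x'' cd yd] : [/\ x <= b, a <= x', c <= d & y <= d] by split; lra.
  have -> : rint G a b c d = rint G x x' y y'.
    have B1 := cG a b c d (lexx _) (lexx _) (lexx _) (lexx _) (nB _ _ _ _ lpx lpx' lpy lpy').
    have B2 := cG x b c d hax (lexx _) (lexx _) (lexx _) (nB _ _ _ _ px lpx' lpy lpy').
    have B3 := cG x x' c d hax hxb (lexx _) (lexx _) (nB _ _ _ _ px px' lpy lpy').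
    have B4 := cG x x' y d hax hxb hcy (lexx _) (nB _ _ _ _ px px' py lpy').
    have Z1 : rint G a x c d = 0.
      apply: G0 => //; first lra.
      by move=> [/andP[_]]; rewrite leNgt px.
    have Z2 : rint G x' b c d = 0.
      apply: G0 => //; first lra.
      by move=> [/andP[]]; rewrite leNgt px'.
    have Z3 : rint G x x' c y = 0.
      apply: G0 => //.
      by move=> [_ /andP[_]]; rewrite leNgt py.
    have Z4 : rint G x x' y' d = 0.
      apply: G0 => //; first lra.
      by move=> [_ /andP[]]; rewrite leNgt py'.
    rewrite (rint_splitx hax xb cd B1) Z1 add0r (rint_splitx hxx hxb cd B2) Z2 addr0.
    by rewrite (rint_splity hxx hcy yd B3) Z3 add0r (rint_splity hxx hyy hyd B4) Z4 addr0.
  apply: le_trans.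
    apply: (@rint_bound _ _ _ _ _ _ _ _ M); try exact: ltW.
      by apply: cG => //; exact: nB.
    move=> z Bz; apply: GM; apply/andP; split.
      rewrite normc_gt0 subr_eq0; apply/eqP => zp.
      by move: Bz; rewrite zp; exact: nB.
    case: Bz => -[/andP[z1 z2] /andP[z3 z4]] _.
    apply: (le_lt_trans (normc_leD _)); rewrite ReD ReN ImD ImN.
    have : `|Re z - Re p| <= e.
      by rewrite ler_norml; apply/andP; rewrite /x /x' in z1 z2; split; lra.
    have : `|Im z - Im p| <= e.
      by rewrite ler_norml; apply/andP; rewrite /y /y' in z3 z4; split; lra.
    lra.
  rewrite /x /x' /y /y'; lra.
apply/eqP; rewrite -normc_eq0; apply/negPn/negP => N0.
have {N0} : 0 < normc (rint G a b c d) by rewrite lt_def N0 normc_ge0.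
set N := normc _ => N0.
(* The first term makes [16 * M * e] at most [N / 2]; the others keep the square inside the
   rectangle and inside the region where [G] is bounded. *)
pose e := Num.min (N / (32 * (M + 1))) (Num.min (r / 4) (r1 / 2)).
have e0 : 0 < e.
  rewrite /e !lt_min; apply/and3P; split; rewrite divr_gt0//.
  by rewrite mulr_gt0// ltr_wpDl.
have [e1 e2 e3] : [/\ e <= N / (32 * (M + 1)), e <= r / 4 & e <= r1 / 2].
  have : e <= e by [].
  by rewrite {2}/e !le_min => /and3P[].
have := small e e0; rewrite -/N.
have er : 2 * e < r by lra.
have er1 : e < r1 by lra.
move=> /(_ er er1) h.
have : 16 * M * e <= 16 * (M + 1) * (N / (32 * (M + 1))).
  by apply: ler_pM => //; [rewrite mulr_ge0|exact: ltW|lra].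
rewrite (_ : 16 * (M + 1) * (N / (32 * (M + 1))) = N / 2); first lra.
by field; rewrite gt_eqF// ltr_wpDl.
Qed.

Lemma derive_quotient_near F p z : derivable F z 1 -> z != p ->
  derivable (fun w => (F w - F p) / (w - p)) z 1.
Proof.
move=> dF zp.
have dsub : derivable (fun w : R[i] => w - p) z 1.
  by apply: derivableB; [exact: derivable_id|exact: derivable_cst].
have h := derivableV (f := fun w : R[i] => w - p) (x := z) (v := 1).
apply: (@derivableM _ _ (fun w => F w - F p) (fun w => (w - p)^-1)).
  by apply: derivableB; [exact: dF|exact: derivable_cst].
by apply: h; [rewrite subr_eq0|exact: dsub].
Qed.

Lemma cts_inv_sub p z : z != p -> {for z, continuous (fun w : R[i] => (w - p)^-1)}.
Proof.
move=> zp; apply: derivable_cts.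
have h := derivableV (f := fun w : R[i] => w - p) (x := z) (v := 1).
apply: h; first by rewrite subr_eq0.
by apply: derivableB; [exact: derivable_id|exact: derivable_cst].
Qed.

Lemma ctsM F G z : {for z, continuous F} -> {for z, continuous G} ->
  {for z, continuous (fun w => F w * G w)}.
Proof. by move=> cF cG; exact: (@continuousM _ _ F G z cF cG). Qed.

(** The quotient [(F z - F p) / (z - p)] is bounded near [p] because [F] is differentiable there, so
    its contour integral vanishes. The classical [2 pi i] appears as the integral of
    [(z - p)^-1]. *)
Lemma cauchy_formula F a b c d p :
  a < Re p < b -> c < Im p < d ->
  (forall z, rect a b c d z -> derivable F z 1) ->
  rint (fun z => F z * (z - p)^-1) a b c d = F p * rint (fun z => (z - p)^-1) a b c d.
Proof.
move=> pab pcd dF.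
pose G z := (F z - F p) / (z - p).
have pr : rect a b c d p.
  by case/andP: pab => ? ?; case/andP: pcd => ? ?; split; rewrite !ltW.
have G0 : rint G a b c d = 0.
  have /is_derive_normcP/(_ 1 ltr01)[r r0 rP] := derivableP (dF p pr).
  set l := derive F p 1 in rP.
  apply: (@goursat_puncture _ _ _ _ _ p (normc l + 1) r) => //.
    by move=> z rz zp; apply: derive_quotient_near => //; exact: dF.
  move=> z /andP[z0 zr]; have zp : z - p != 0 by rewrite -normc_gt0.
  rewrite (_ : G z = l + (F z - F p - l * (z - p)) / (z - p)); last by rewrite /G; field.
  apply: (le_trans (le_normcD _ _)); rewrite lerD2l Normc.normcM Normc.normcV.
  by rewrite ler_pdivrMr//; exact: rP.
have [ab cd] : a <= b /\ c <= d.
  by case/andP: pab => ? ?; case/andP: pcd => ? ?; split; lra.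
have np z : boundary a b c d z -> z != p.
  move=> Bz; apply/eqP => zp; move: Bz; rewrite zp => -[_].
  case/andP: pab => ? ?; case/andP: pcd => ? ?.
  by move=> /orP[/orP[/orP[]|]|] /eqP; lra.
have cF : cts_on (boundary a b c d) F by move=> z [rz _]; apply: derivable_cts; exact: dF.
have ci : cts_on (boundary a b c d) (fun z => (z - p)^-1).
  by move=> z Bz; apply: cts_inv_sub; exact: np.
have cG : cts_on (boundary a b c d) G.
  by move=> z Bz; apply: derivable_cts; apply: derive_quotient_near; [case: Bz => /dF|exact: np].
have cFi : cts_on (boundary a b c d) (fun z => F p * (z - p)^-1).
  by move=> z Bz; apply: (cts_comp (ci z Bz) (F := fun w => F p * w)); exact: cts_mull.
rewrite (@eq_rint _ a b c d ab cd _ (fun z => G z + F p * (z - p)^-1)).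
  by rewrite rintD// G0 add0r rintZ.
by move=> z /np; rewrite -subr_eq0 => zp; rewrite /G; field.
Qed.

End cauchy.

Section holomorphic_derivative.
Variable R : realType.
Implicit Types (s M r : R) (p q z : R[i]) (F phi : R[i] -> R[i]).

Lemma square_boundary_dist p q s z :
  normc (q - p) < s / 2 ->
  boundary (Re p - s) (Re p + s) (Im p - s) (Im p + s) z -> s / 2 <= normc (z - q).
Proof.
move=> qp [_ Bz].
have szp : s <= normc (z - p).
  have [h|h] : s = `|Re (z - p)| \/ s = `|Im (z - p)|.
    have s0 : 0 < s by have := le_lt_trans (normc_ge0 _) qp; rewrite ltr_pdivlMr ?mul0r.
    have E1 (x : R) : s = `|x - s - x| by rewrite addrAC subrr add0r normrN gtr0_norm.
    have E2 (x : R) : s = `|x + s - x| by rewrite addrAC subrr add0r gtr0_norm.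
    rewrite ReD ReN ImD ImN; case/orP: Bz => [/orP[/orP[]|]|] /eqP ->; by [left|right].
  - rewrite {1}h; exact: normc_Re.
  - rewrite {1}h; exact: normc_Im.
have := le_normcD (z - q) (q - p); rewrite subrKA; lra.
Qed.

(* Each side contributes a positive imaginary part, so the exact value
   [2 pi i] is not needed. *)
Lemma winding_neq0 p s : 0 < s ->
  rint (fun z => (z - p)^-1) (Re p - s) (Re p + s) (Im p - s) (Im p + s) != 0.
Proof.
move=> s0; have s20 : 0 < s ^+ 2 by rewrite exprn_gt0.
have [ab cd] : Re p - s <= Re p + s /\ Im p - s <= Im p + s by split; lra.
have ci : cts_on (boundary (Re p - s) (Re p + s) (Im p - s) (Im p + s)) (fun z => (z - p)^-1).
  move=> z /(@square_boundary_dist p p s); rewrite subrr Normc.normc0 divr_gt0// => /(_ erefl) h.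
  by apply: cts_inv_sub; rewrite -subr_eq0 -normc_gt0 (lt_le_trans _ h) ?divr_gt0.
have [c1 c2 c3 c4] := cts_on_sides ab cd ci.
have cM (u : R -> R[i]) k x y : ctsab x y u -> ctsab x y (fun t => k * u t).
  by move=> cu t /cu cut; exact: (cts_comp cut (@cts_mull _ _ _)).
have bound t : `|t| <= s -> s^-1 / 2 <= s / (s ^+ 2 + t ^+ 2).
  move=> ts; rewrite ler_pdivlMr ?ltr_wpDr ?sqr_ge0//.
  have t2 : t ^+ 2 <= s ^+ 2 by rewrite -(real_normK (num_real t)) ler_pXn2r ?nnegrE// ltW.
  have : s^-1 / 2 * (s ^+ 2 + t ^+ 2) <= s^-1 / 2 * (s ^+ 2 + s ^+ 2).
    by rewrite ler_pM2l ?divr_gt0 ?invr_gt0// lerD2l.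
  by rewrite (_ : s^-1 / 2 * (s ^+ 2 + s ^+ 2) = s)//; field; rewrite gt_eqF.
(* After multiplication by 1, -1, ['i] or [- 'i], the integrand on every side has this same positive
   imaginary part. *)
have I1 u x : ctsab (x - s) (x + s) u ->
    (forall t, `|t - x| <= s -> Im (u t) = s / (s ^+ 2 + (t - x) ^+ 2)) ->
    0 < Im (cint (x - s) (x + s) u).
  move=> cu uE; apply: (@lt_le_trans _ _ (s^-1 / 2 * ((x + s) - (x - s)))).
    by rewrite mulr_gt0 ?divr_gt0 ?invr_gt0//; lra.
  apply: cint_Im_ge => //; first lra.
  move=> t /andP[t1 t2]; have ts : `|t - x| <= s by rewrite ler_norml; apply/andP; split; lra.
  by rewrite uE//; exact: bound.
have hA : 0 < Im (cint (Re p - s) (Re p + s) (fun t => (t +i* (Im p - s) - p)^-1)).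
  apply: (I1 _ _ c1) => t _; case: (p) => x y /=.
  by rewrite addrAC subrr add0r mulNr opprK sqrrN addrC.
have hB : Im (cint (Re p - s) (Re p + s) (fun t => (t +i* (Im p + s) - p)^-1)) < 0.
  suff : 0 < Im (-1 * cint (Re p - s) (Re p + s) (fun t => (t +i* (Im p + s) - p)^-1)).
    by rewrite mulN1r ImN oppr_gt0.
  rewrite -(cintZ _ c2).
  apply: (I1 _ _ (cM _ (-1) _ _ c2)) => t _; rewrite mulN1r; case: (p) => x y /=.
  by rewrite addrAC subrr add0r opprK addrC.
have hC : 0 < Re (cint (Im p - s) (Im p + s) (fun t => ((Re p + s) +i* t - p)^-1)).
  suff : 0 < Im ('i * cint (Im p - s) (Im p + s) (fun t => ((Re p + s) +i* t - p)^-1)).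
    by rewrite ImM /= mul0r mul1r add0r.
  rewrite -(cintZ _ c4).
  apply: (I1 _ _ (cM _ 'i _ _ c4)) => t _; rewrite ImM /= mul0r mul1r add0r; case: (p) => x y /=.
  by rewrite addrAC subrr add0r.
have hD : Re (cint (Im p - s) (Im p + s) (fun t => ((Re p - s) +i* t - p)^-1)) < 0.
  suff : 0 < Im (- 'i * cint (Im p - s) (Im p + s) (fun t => ((Re p - s) +i* t - p)^-1)).
    by rewrite ImM /= oppr0 mul0r add0r mulN1r oppr_gt0.
  rewrite -(cintZ _ c3).
  apply: (I1 _ _ (cM _ (- 'i) _ _ c3)) => t _.
  rewrite ImM /= oppr0 mul0r add0r mulN1r; case: (p) => x y /=.
  by rewrite addrAC subrr add0r mulNr opprK sqrrN.
apply/eqP => /(congr1 (@complex.Im R)).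
rewrite /rint !ImD ImN ImM ReD ReN [Re 'i]/= [Im 'i]/= [Im 0]/=.
lra.
Qed.

End holomorphic_derivative.

(** * Differentiability of the complex derivative *)

Section derivative_of_holomorphic.
Variable R : realType.
Implicit Types (s M r K : R) (p q z w : R[i]) (F phi : R[i] -> R[i]).

Lemma derivable_mulc F phi z : derivable F z 1 -> derivable phi z 1 ->
  derivable (fun w => F w * phi w) z 1.
Proof. by move=> dF dp; exact: (@derivableM _ _ F phi z 1 dF dp). Qed.

Lemma derivable_subc F phi z : derivable F z 1 -> derivable phi z 1 ->
  derivable (fun w => F w - phi w) z 1.
Proof. by move=> dF dp; exact: (@derivableB _ _ _ F phi z 1 dF dp). Qed.

(** Differentiation under the integral sign: a quadratic remainder, uniform on the contour, takes
    the place of dominated convergence. *)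
Lemma rint_is_derive (a b c d : R) (psi : R[i] -> R[i] -> R[i]) (dpsi : R[i] -> R[i]) q r K :
  a <= b -> c <= d -> 0 < r -> 0 <= K ->
  (forall z w, boundary a b c d z -> normc (w - q) < r ->
    normc (psi w z - psi q z - (w - q) * dpsi z) <= K * normc (w - q) ^+ 2) ->
  (forall w, normc (w - q) < r -> cts_on (boundary a b c d) (psi w)) ->
  cts_on (boundary a b c d) dpsi ->
  is_derive q 1 (fun w => rint (psi w) a b c d) (rint dpsi a b c d).
Proof.
move=> ab cd r0 K0 psiK cpsi cdpsi; apply/is_derive_normcP => e e0.
pose L := (b - a) + (d - c).
have L0 : 0 <= L by rewrite /L; lra.
have KL0 : 0 < 4 * K * L + 1 by rewrite ltr_wpDl// mulr_ge0// mulr_ge0.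
exists (Num.min r (e / (4 * K * L + 1))).
  by rewrite lt_min r0 divr_gt0.
move=> w; rewrite lt_min => /andP[wr we].
have cq : cts_on (boundary a b c d) (psi q).
  by apply: cpsi; rewrite subrr Normc.normc0.
have cZ k G : cts_on (boundary a b c d) G -> cts_on (boundary a b c d) (fun z => k * G z).
  by move=> cG z /cG cz; exact: (cts_comp cz (@cts_mull _ _ _)).
have cA : cts_on (boundary a b c d) (fun z => -1 * psi q z + (- (w - q)) * dpsi z).
  by move=> z Bz; apply: continuousD; [exact: (cZ _ _ cq)|exact: (cZ _ _ cdpsi)].
have -> : rint (psi w) a b c d - rint (psi q) a b c d - rint dpsi a b c d * (w - q) =
    rint (fun z => psi w z + (-1 * psi q z + (- (w - q)) * dpsi z)) a b c d.
  rewrite (rintD ab cd (cpsi w wr) cA) (rintD ab cd (cZ _ _ cq) (cZ _ _ cdpsi)).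
  rewrite (rintZ ab cd _ cq) (rintZ ab cd _ cdpsi); ring.
apply: le_trans.
  apply: (@rint_bound _ a b c d ab cd _ (K * normc (w - q) ^+ 2)).
    by move=> z Bz; apply: continuousD; [exact: (cpsi w wr)|exact: cA].
  move=> z Bz; have := psiK z w Bz wr.
  by rewrite (_ : _ - _ - _ = psi w z + (-1 * psi q z + - (w - q) * dpsi z))//; ring.
rewrite (_ : 4 * (K * normc (w - q) ^+ 2) * _ =
  (4 * K * L) * normc (w - q) * normc (w - q)); last by rewrite /L; ring.
rewrite ler_wpM2r ?normc_ge0//.
move: we; rewrite ltr_pdivlMr// => we; apply: le_trans (ltW we).
by rewrite mulrC ler_wpM2l ?normc_ge0// lerDl.
Qed.

(** Up to the factor [(k - 1)! / (2 pi i)], Cauchy's integral for the derivative of order [k - 1],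
    over a square that stays fixed while [q] moves. *)
Definition cauchy_kernel phi p s k q : R[i] :=
  rint (fun z => phi z * ((z - q)^-1) ^+ k) (Re p - s) (Re p + s) (Im p - s) (Im p + s).

Lemma cauchy_kernel1 phi p s q : cauchy_kernel phi p s 1 q =
  rint (fun z => phi z * (z - q)^-1) (Re p - s) (Re p + s) (Im p - s) (Im p + s).
Proof. by []. Qed.

Lemma cauchy_kernel_cst1 p s q : cauchy_kernel (fun=> 1) p s 1 q =
  rint (fun z => (z - q)^-1) (Re p - s) (Re p + s) (Im p - s) (Im p + s).
Proof.
rewrite cauchy_kernel1.
by have -> : (fun z => 1 * (z - q)^-1) = (fun z => (z - q)^-1)
  by apply/funext => z; rewrite mul1r.
Qed.

(** The remainder factors exactly as [d ^ 2] times one monomial in the inverses for [k = 1], and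
    times three monomials counted with coefficients for [k = 2]; hence the constant 3. Two values of
    [k] correspond to two differentiations. *)
Lemma kernel_estimate u v d r k : (k = 1 \/ k = 2)%N -> 0 < r ->
  r <= normc u -> r <= normc v -> u - v = d ->
  normc (v^-1 ^+ k - u^-1 ^+ k - d * (k%:R * u^-1 ^+ k.+1)) <=
   3 * (r^-1) ^+ k.+2 * normc d ^+ 2.
Proof.
move=> k12 r0 ru rv uvd.
have u0 : u != 0 by rewrite -normc_gt0 (lt_le_trans r0).
have v0 : v != 0 by rewrite -normc_gt0 (lt_le_trans r0).
have iu : normc u^-1 <= r^-1 by rewrite Normc.normcV lef_pV2 ?posrE ?(lt_le_trans r0).
have iv : normc v^-1 <= r^-1 by rewrite Normc.normcV lef_pV2 ?posrE ?(lt_le_trans r0).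
have rV0 : 0 <= r^-1 by rewrite invr_ge0 ltW.
have B i j : normc (u^-1 ^+ i * v^-1 ^+ j) <= r^-1 ^+ (i + j).
  by rewrite Normc.normcM !normcX exprD ler_pM ?exprn_ge0 ?normc_ge0// lerXn2r ?nnegrE ?normc_ge0.
case: k12 => ->.
  rewrite (_ : _ - _ - _ = (u^-1 ^+ 2 * v^-1 ^+ 1) * d ^+ 2); last first.
    by rewrite -uvd; field; rewrite u0 v0.
  rewrite Normc.normcM [normc (d ^+ 2)]normcX ler_wpM2r ?exprn_ge0 ?normc_ge0//.
  apply: (le_trans (B _ _)).
  by rewrite ler_peMl ?exprn_ge0// ler1n.
rewrite (_ : _ - _ - _ = (u^-1 ^+ 2 * v^-1 ^+ 2 + 2 * (u^-1 ^+ 3 * v^-1 ^+ 1)) * d ^+ 2);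
  last first.
  by rewrite -uvd; field; rewrite u0 v0.
rewrite Normc.normcM [normc (d ^+ 2)]normcX ler_wpM2r ?exprn_ge0 ?normc_ge0//.
apply: (le_trans (le_normcD _ _)).
have n2 : normc (2 : R[i]) = 2 by rewrite -(rmorph_nat (real_complex R) 2) normc_real gtr0_norm.
rewrite [normc (2 * _)]Normc.normcM n2.
have := B 2%N 2%N; have := B 3%N 1%N; rewrite /= ; lra.
Qed.

Lemma cauchy_kernel_derive phi p s M k q : (k = 1 \/ k = 2)%N -> 0 < s ->
  let B := boundary (Re p - s) (Re p + s) (Im p - s) (Im p + s) in
  cts_on B phi -> (forall z, B z -> normc (phi z) <= M) ->
  normc (q - p) < s / 2 ->
  is_derive q 1 (cauchy_kernel phi p s k) (k%:R * cauchy_kernel phi p s k.+1 q).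
Proof.
move=> k12 s0 B cphi phiM qp.
have M0 : 0 <= M.
  apply: le_trans (phiM ((Re p - s) +i* (Im p - s)) _); first exact: normc_ge0.
  by rewrite /B /boundary /rect /= !lexx eqxx /=; do 2 split => //; lra.
have [ab cd] : Re p - s <= Re p + s /\ Im p - s <= Im p + s by split; lra.
have far w : normc (w - q) < s / 2 - normc (q - p) -> forall z, B z -> s / 2 <= normc (z - w).
  move=> wq z Bz; apply: square_boundary_dist Bz.
  rewrite -(subrKA q); apply: le_lt_trans (le_normcD _ _) _; lra.
have s20 : 0 < s / 2 by rewrite divr_gt0.
have ck w j : normc (w - q) < s / 2 - normc (q - p) ->
    cts_on B (fun z => phi z * ((z - w)^-1) ^+ j).
  move=> wq z Bz; apply: ctsM; first exact: cphi.
  have zw : z != w by rewrite -subr_eq0 -normc_gt0 (lt_le_trans s20)// (far w wq).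
  elim: j => [|j IH]; first exact: cst_continuous.
  have h := ctsM (cts_inv_sub zw) IH.
  by have -> : (fun z0 => (z0 - w)^-1 ^+ j.+1) = (fun z0 => (z0 - w)^-1 * (z0 - w)^-1 ^+ j)
    by apply/funext => x; rewrite exprS.
have qq : normc (q - q) < s / 2 - normc (q - p) by rewrite subrr Normc.normc0 subr_gt0.
have cq j : cts_on B (fun z => k%:R * (phi z * ((z - q)^-1) ^+ j)).
  by move=> z Bz; apply: (cts_comp (ck q j qq z Bz) (@cts_mull _ _ _)).
rewrite /cauchy_kernel -(rintZ ab cd _ (ck q k.+1 qq)).
apply: (@rint_is_derive _ _ _ _ _ _ _ (s / 2 - normc (q - p)) (M * (3 * (s / 2)^-1 ^+ k.+2))).
- exact: ab.
- exact: cd.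
- by rewrite subr_gt0.
- by rewrite mulr_ge0// mulr_ge0// exprn_ge0// invr_ge0 ltW.
- move=> z w Bz wq.
  have := @kernel_estimate (z - q) (z - w) (w - q) (s / 2) k k12 s20
    (far _ qq _ Bz) (far _ wq _ Bz).
  move=> /(_ (ltac:(ring))) est.
  rewrite (_ : _ - _ - _ = phi z * ((z - w)^-1 ^+ k - (z - q)^-1 ^+ k -
     (w - q) * (k%:R * (z - q)^-1 ^+ k.+1))); last by ring.
  by rewrite Normc.normcM -mulrA ler_pM ?normc_ge0// phiM.
- by move=> w; exact: ck.
- exact: cq.
Qed.

(* Near [p], [F] is the quotient of two Cauchy integrals over a fixed square,
   [cauchy_kernel F p s 1] and [cauchy_kernel (fun=> 1) p s 1], and these can
   be differentiated twice. *)
Theorem derivable_derive1 F p : (\forall z \near p, derivable F z 1) ->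
  derivable F^`()%classic p 1.
Proof.
move=> /near_normcP[r r0 dF].
have /cts_normcP/(_ 1 ltr01)[r1 r10 F1] : {for p, continuous F}.
  by apply: derivable_cts; apply: dF; rewrite subrr Normc.normc0.
(* The square of half-side [s] lies within distance [2 * s] of [p], hence where [F] is
   differentiable and bounded by [normc (F p) + 1]. *)
pose s := Num.min r r1 / 4.
have s0 : 0 < s by rewrite divr_gt0// lt_min r0.
have [sr sr1] : 4 * s <= r /\ 4 * s <= r1.
  by rewrite /s; split; rewrite mulrC divfK ?ge_min ?lexx ?orbT.
set a := Re p - s; set b := Re p + s; set c := Im p - s; set d := Im p + s.
have inr z : rect a b c d z -> normc (z - p) < 4 * s.
  move=> [/andP[z1 z2] /andP[z3 z4]]; apply: (le_lt_trans (normc_leD _)).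
  rewrite ReD ReN ImD ImN.
  have : `|Re z - Re p| <= s by rewrite ler_norml; apply/andP; rewrite /a /b in z1 z2; split; lra.
  have : `|Im z - Im p| <= s by rewrite ler_norml; apply/andP; rewrite /c /d in z3 z4; split; lra.
  lra.
have dFr z : rect a b c d z -> derivable F z 1.
  by move=> /inr h; apply: dF; exact: lt_le_trans sr.
have cF : cts_on (boundary a b c d) F.
  by move=> z [rz _]; apply: derivable_cts; exact: dFr.
have FM z : boundary a b c d z -> normc (F z) <= normc (F p) + 1.
  move=> [/inr rz _]; have := F1 z (lt_le_trans rz sr1).
  by have := le_normcD (F z - F p) (F p); rewrite subrK; lra.
pose H := cauchy_kernel F p s; pose W := cauchy_kernel (fun=> 1) p s.
have dH k q : (k = 1 \/ k = 2)%N -> normc (q - p) < s / 2 ->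
    is_derive q 1 (H k) (k%:R * H k.+1 q).
  by move=> k12 qs; exact: (cauchy_kernel_derive k12 s0 cF FM qs).
have dW k q : (k = 1 \/ k = 2)%N -> normc (q - p) < s / 2 ->
    is_derive q 1 (W k) (k%:R * W k.+1 q).
  move=> k12 qs; apply: (@cauchy_kernel_derive _ p s 1 k q k12 s0 _ _ qs).
    by move=> z _; exact: cst_continuous.
  by move=> z _; rewrite Normc.normc1.
have W1E q := cauchy_kernel_cst1 p s q.
have E q : normc (q - p) < s / 2 -> H 1%N q = F q * W 1%N q.
  move=> qs; have h1 := le_lt_trans (normc_Re _) qs; have h2 := le_lt_trans (normc_Im _) qs.
  move: h1 h2; rewrite ReD ReN ImD ImN !ltr_norml => /andP[h1 h2] /andP[h3 h4].
  have [q1 q2] : a < Re q < b /\ c < Im q < d.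
    by split; apply/andP; rewrite /a /b /c /d; split; lra.
  by rewrite /H /W cauchy_kernel_cst1 cauchy_kernel1; exact: (cauchy_formula q1 q2 dFr).
have pp : normc (p - p) < s / 2 by rewrite subrr Normc.normc0 divr_gt0.
have W0 : W 1%N p != 0 by rewrite /W W1E; exact: winding_neq0.
have cW : {for p, continuous (W 1%N)}.
  by have [dW1 _] := dW 1%N p (or_introl erefl) pp; exact: derivable_cts.
have /cts_normcP/(_ (normc (W 1%N p)))[|r2 r20 Wr2] := cW; first by rewrite normc_gt0.
have Wn q : normc (q - p) < r2 -> W 1%N q != 0.
  move=> /Wr2 h; apply/eqP => Wq; move: h.
  by rewrite Wq sub0r normcN ltxx.
have near_p (P : R[i] -> Prop) : (forall q, normc (q - p) < Num.min r2 (s / 2) -> P q) ->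
    \forall q \near p, P q.
  by move=> h; apply/near_normcP; exists (Num.min r2 (s / 2)) => //; rewrite lt_min r20 divr_gt0.
have FE q : normc (q - p) < Num.min r2 (s / 2) -> F q = H 1%N q * (W 1%N q)^-1.
  by rewrite lt_min => /andP[/Wn w0 /E ->]; rewrite mulfK.
(* Quotient rule for [H 1 / W 1], the derivatives of [H 1] and [W 1] being [H 2] and [W 2]. These
   are differentiable in turn, hence so is [D]. *)
pose D q := H 2%N q * (W 1%N q)^-1 - H 1%N q * W 2%N q * ((W 1%N q)^-1 * (W 1%N q)^-1).
have dWV q : normc (q - p) < Num.min r2 (s / 2) -> is_derive q 1 (fun w => (W 1%N w)^-1)
    (- (W 2%N q) * ((W 1%N q)^-1 * (W 1%N q)^-1)).
  rewrite lt_min => /andP[/Wn w0 qs].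
  have [dW1 eW] := dW 1%N q (or_introl erefl) qs.
  split; first exact: (@derivableV _ _ (W 1%N) q 1 w0 dW1).
  rewrite (@deriveV _ _ (W 1%N) q 1 w0 dW1) eW mul1r -[_ *: _]/(_ * _) mulNr mulNr.
  by rewrite -invfM expr2 mulrC.
have dF1 q : normc (q - p) < Num.min r2 (s / 2) -> F^`()%classic q = D q.
  move=> qr; have := qr; rewrite lt_min => /andP[q2 qs].
  have eqn : {near q, F =1 (fun w => H 1%N w * (W 1%N w)^-1)}.
    apply/near_normcP; exists (Num.min r2 (s / 2) - normc (q - p)); first by rewrite subr_gt0.
    move=> w wq; apply: FE; rewrite -(subrKA q).
    by apply: le_lt_trans (le_normcD _ _) _; rewrite -ltrBrDr.
  rewrite derive1E (near_eq_derive _ eqn).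
  have [dH1 eH] := dH 1%N q (or_introl erefl) qs.
  have [dV1 eV] := dWV q qr.
  rewrite (@deriveM _ _ (H 1%N) (fun w => (W 1%N w)^-1) q 1 dH1 dV1) eH eV.
  rewrite mul1r -![_ *: _]/(_ * _) /D; ring.
apply: (@near_eq_derivable _ _ _ D); last first.
  have [dH2 _] := dH 2%N p (or_intror erefl) pp.
  have [dH1 _] := dH 1%N p (or_introl erefl) pp.
  have [dW2 _] := dW 2%N p (or_intror erefl) pp.
  have [dV1 _] : is_derive p 1 (fun w => (W 1%N w)^-1)
    (- (W 2%N p) * ((W 1%N p)^-1 * (W 1%N p)^-1)).
    by apply: dWV; rewrite lt_min subrr Normc.normc0 r20 divr_gt0.
  have h1 := derivable_mulc dH2 dV1.
  have h2 := derivable_mulc (derivable_mulc dH1 dW2) (derivable_mulc dV1 dV1).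
  exact: (derivable_subc h1 h2).
by apply: near_p => q /dF1.
Qed.

End derivative_of_holomorphic.

(** * Mean value estimates *)

Section lines.
Variable R : realType.
Implicit Types (s t a b x y M : R) (p v z w : R[i]) (F : R[i] -> R[i]).
Local Notation mu := (@lebesgue_measure R).

Lemma is_derive_realP (f : R -> R) t l :
  (forall e, 0 < e -> exists2 d, 0 < d & forall s, `|s - t| < d ->
     `|f s - f t - l * (s - t)| <= e * `|s - t|) -> is_derive t 1 f l.
Proof.
move=> H.
suff E : (fun h : R => h^-1 *: (f (h *: 1 + t) - f t)) @ (0 : R)^' --> l.
  split; first by apply/cvg_ex; exists l.
  exact: cvg_lim E.
apply/cvgrPdist_lt => e e0.
have e20 : 0 < e / 2 by rewrite divr_gt0.
have [d d0 dP] := H (e / 2) e20.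
apply/nbhs_ballP; exists d => // h; rewrite /ball /= sub0r normrN => hd h0.
have := dP (h + t); rewrite addrK => /(_ hd) hP.
rewrite distrC -[h *: 1]/(h * 1) mulr1 -[_ *: _]/(_ * _).
have -> : h^-1 * (f (h + t) - f t) - l = (f (h + t) - f t - l * h) * h^-1.
  by rewrite mulrBl mulfK// mulrC.
rewrite normrM normfV ltr_pdivrMr ?normr_gt0//.
apply: (le_lt_trans hP); rewrite ltr_pM2r ?normr_gt0//.
by rewrite ltr_pdivrMr// ltr_pMr// ltr1n.
Qed.

(** The mean value theorem holds for real functions only; this interface treats the real and
    imaginary parts in one proof. *)
Definition real_part_like (L : R[i] -> R) :=
  [/\ forall z w, L (z - w) = L z - L w, forall x z, L (x%:C * z) = x * L z &
      forall z, `|L z| <= normc z].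

Lemma Re_part_like : real_part_like (@complex.Re R).
Proof.
split; last exact: normc_Re.
- by move=> z w; rewrite ReD ReN.
- by move=> x z; rewrite ReM /= mul0r subr0.
Qed.

Lemma Im_part_like : real_part_like (@complex.Im R).
Proof.
split; last exact: normc_Im.
- by move=> z w; rewrite ImD ImN.
- by move=> x z; rewrite ImM /= mul0r addr0.
Qed.

Lemma is_derive_line L F p v t : real_part_like L -> derivable F (p + t%:C * v) 1 ->
  is_derive t 1 (fun s => L (F (p + s%:C * v))) (L (F^`()%classic (p + t%:C * v) * v)).
Proof.
move=> [LB LZ LN] dF; apply: is_derive_realP => e e0.
have /is_derive_normcP := derivableP dF; rewrite -derive1E; set l := derive1 F _.
have v1 : 0 < normc v + 1 by rewrite ltr_wpDl ?normc_ge0.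
move=> /(_ (e / (normc v + 1)))[|d d0 dP]; first by rewrite divr_gt0.
exists (d / (normc v + 1)); first by rewrite divr_gt0.
move=> s sd.
have E : p + s%:C * v - (p + t%:C * v) = (s - t)%:C * v by rewrite rmorphB /=; ring.
have NE : normc ((s - t)%:C * v) = `|s - t| * normc v by rewrite Normc.normcM normc_real.
have := dP (p + s%:C * v); rewrite E NE => H.
rewrite -LB -[L _ * (s - t)]mulrC -LZ -LB.
apply: (le_trans (LN _)).
rewrite (_ : (s - t)%:C * _ = l * ((s - t)%:C * v)); last by ring.
apply: (le_trans (H _)).
  apply: le_lt_trans (_ : `|s - t| * (normc v + 1) < d); last by rewrite -ltr_pdivlMr.
  by rewrite ler_wpM2l// lerDl.
have -> : e / (normc v + 1) * (`|s - t| * normc v) = e * `|s - t| * (normc v / (normc v + 1)).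
  by field; rewrite gt_eqF.
apply: ler_piMr; first by rewrite mulr_ge0// ltW.
by rewrite ler_pdivrMr// mul1r lerDl.
Qed.

Lemma derive_cts_real (f : R -> R) t l : is_derive t 1 f l -> {for t, continuous f}.
Proof. by move=> [df _]; apply: differentiable_continuous; apply/derivable1_diffP. Qed.

Lemma mean_value_part L F z w M : real_part_like L ->
  (forall t, 0 <= t <= 1 -> derivable F (z + t%:C * (w - z)) 1 /\
     normc (F^`()%classic (z + t%:C * (w - z))) <= M) ->
  `|L (F w) - L (F z)| <= M * normc (w - z).
Proof.
move=> LL H.
have dL t : 0 <= t <= 1 -> is_derive t 1 (fun s => L (F (z + s%:C * (w - z))))
    (L (F^`()%classic (z + t%:C * (w - z)) * (w - z))).
  by move=> /H[dF _]; exact: is_derive_line.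
have [||c] := MVT_segment (@ler01 R) (f := fun s => L (F (z + s%:C * (w - z))))
   (df := fun t => L (F^`()%classic (z + t%:C * (w - z)) * (w - z))).
- move=> x; rewrite in_itv /= => /andP[x0 x1]; apply: dL.
  by rewrite !ltW.
- apply: continuous_in_subspaceT => t; rewrite inE /= in_itv /= => t01.
  exact: derive_cts_real (dL t t01).
have E1 : z + 1%:C * (w - z) = w by rewrite rmorph1 mul1r addrC subrK.
have E0 : z + 0%:C * (w - z) = z by rewrite rmorph0 mul0r addr0.
rewrite in_itv E1 E0 subr0 mulr1 => c01 ->.
have [_ _ LN] := LL; apply: (le_trans (LN _)); rewrite Normc.normcM.
by rewrite ler_wpM2r ?normc_ge0//; have [] := H c c01.
Qed.

Lemma mean_value F z w M :
  (forall t, 0 <= t <= 1 -> derivable F (z + t%:C * (w - z)) 1 /\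
     normc (F^`()%classic (z + t%:C * (w - z))) <= M) ->
  normc (F w - F z) <= 2 * M * normc (w - z).
Proof.
move=> H; apply: (le_trans (normc_leD _)); rewrite ReD ReN ImD ImN.
have := mean_value_part Re_part_like H; have := mean_value_part Im_part_like H.
lra.
Qed.

(** The additive 1 makes the weight [k], the square root of [A + 1], positive even when [du]
    vanishes identically. *)
Lemma sqr_increment_le (u du : R -> R) a b : a < b -> b - a <= 1 ->
  (forall t, a <= t <= b -> is_derive t 1 u (du t)) -> ctsab a b du ->
  (((u b - u a) ^+ 2)%:E <= \int[mu]_(t in `[a, b]) ((du t) ^+ 2)%:E + 1)%E.
Proof.
move=> ab ab1 dU cdu.
have cts_sq : ctsab a b (fun t => du t ^+ 2).
  have -> : (fun t => du t ^+ 2) = (fun t => du t * du t) by apply/funext => t; rewrite expr2.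
  by move=> t /cdu ct; exact: (@continuousM _ _ du du t ct ct).
have isq := ctsab_integrable cts_sq; have idu := ctsab_integrable cdu.
have ftc : (\int[mu]_(x in `[a, b]) (du x)%:E = (u b)%:E - (u a)%:E)%E.
  apply: continuous_FTC2 => //.
  - apply: continuous_in_subspaceT => t; rewrite inE /= in_itv /=; exact: cdu.
  - split.
    + move=> x; rewrite in_itv /= => /andP[ax xb]; apply: ex_derive.
      by apply: dU; rewrite !ltW.
    + apply: cvg_at_right_filter; apply: derive_cts_real; apply: dU.
      by rewrite lexx ltW.
    + apply: cvg_at_left_filter; apply: derive_cts_real; apply: dU.
      by rewrite lexx ltW.
  - move=> x; rewrite in_itv /= => /andP[ax xb]; rewrite derive1E.
    by apply: derive_val; apply: dU; rewrite !ltW.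
have mI : measurable (`[a, b]%classic : set (measurableTypeR R)) by exact: measurable_itv.
pose A := (\int[mu]_(t in `[a, b]) (du t) ^+ 2)%R.
have AE : (\int[mu]_(t in `[a, b]) ((du t) ^+ 2)%:E = A%:E)%E.
  by rewrite /A /Rintegral fineK//; exact: integrable_fin_num.
have A0 : 0 <= A by apply: Rintegral_ge0 => t _; exact: sqr_ge0.
have rftc : (\int[mu]_(t in `[a, b]) du t = u b - u a)%R.
  by rewrite /Rintegral ftc.
rewrite AE -EFinD lee_fin -rftc.
(* Cauchy-Schwarz in the AM-GM form [|du| <= k / 2 + du ^ 2 / (2 k)]. *)
pose k := Num.sqrt (A + 1).
have k2 : k ^+ 2 = A + 1 by rewrite sqr_sqrtr// addr_ge0.
have k0 : 0 < k by rewrite sqrtr_gt0 ltr_wpDl.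
rewrite -k2 -real_normK ?num_real// ler_pXn2r ?nnegrE ?normr_ge0 ?(ltW k0)//.
apply: le_trans; first by apply: le_normr_Rintegral.
have iZ : mu.-integrable `[a, b] (EFin \o (fun t => k / 2 + (2 * k)^-1 * du t ^+ 2)).
  apply: ctsab_integrable => t tab.
  apply: continuousD; first exact: cst_continuous.
  apply: (@continuousM _ _ (fun=> (2 * k)^-1) (fun t => du t ^+ 2)); first exact: cst_continuous.
  exact: cts_sq.
apply: (@le_trans _ _ (\int[mu]_(t in `[a, b]) (k / 2 + (2 * k)^-1 * du t ^+ 2))%R).
  apply: le_Rintegral => //.
    apply: ctsab_integrable => t /cdu ct.
    exact: (@continuous_comp _ _ _ du (fun x => `|x|) t ct (@norm_continuous _ _ _)).
  move=> t _; rewrite -subr_ge0 -[du t ^+ 2]real_normK ?num_real//.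
  rewrite (_ : _ - _ = (2 * k)^-1 * (k - `|du t|) ^+ 2); last by field; rewrite gt_eqF.
  by rewrite mulr_ge0 ?sqr_ge0// invr_ge0 mulr_ge0// ltW.
rewrite RintegralD//; last 2 first.
- by apply: ctsab_integrable => t _; exact: cst_continuous.
- apply: ctsab_integrable => t tab.
  apply: (@continuousM _ _ (fun=> (2 * k)^-1) (fun t => du t ^+ 2)); first exact: cst_continuous.
  exact: cts_sq.
rewrite Rintegral_cst// (length_itvcc (ltW ab)) RintegralZl// -/A.
have : k / 2 * (b - a) <= k / 2 * 1 by rewrite ler_pM2l// divr_gt0.
have : (2 * k)^-1 * A <= (2 * k)^-1 * k ^+ 2.
  by rewrite ler_pM2l ?invr_gt0 ?mulr_gt0// k2 lerDl.
rewrite (_ : (2 * k)^-1 * k ^+ 2 = k / 2); last by field; rewrite gt_eqF.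
lra.
Qed.

End lines.

(** * Difference quotients *)

Section difference_quotient.
Variable R : realType.
Implicit Types (a p z w : R[i]) (F : R[i] -> R[i]).

Definition dquot F a z : R[i] :=
  if z == a then F^`()%classic a else (F z - F a) / (z - a).

Lemma dquotP F a z : F z = F a + (z - a) * dquot F a z.
Proof.
rewrite /dquot; case: eqVneq => [->|za]; first by rewrite subrr mul0r addr0.
by rewrite mulrC divfK ?subr_eq0// addrC subrK.
Qed.

Lemma is_derive_quadratic (c0 c1 c2 : R[i]) a w :
  is_derive w 1 (fun z => c0 + c1 * (z - a) + c2 * (z - a) ^+ 2) (c1 + 2 * c2 * (w - a)).
Proof.
apply/is_derive_normcP => e e0.
have c0' : 0 < normc c2 + 1 by rewrite ltr_wpDl ?normc_ge0.
exists (e / (normc c2 + 1)); first by rewrite divr_gt0.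
move=> z; rewrite ltr_pdivlMr// => ze.
rewrite (_ : _ - _ - _ = c2 * (z - w) * (z - w)); last by ring.
rewrite !Normc.normcM ler_wpM2r ?normc_ge0//; apply: le_trans (ltW ze).
by rewrite mulrC ler_wpM2l ?normc_ge0// lerDl.
Qed.

(** At [a] the derivative is half the second derivative [l] of [F]. The remainder [G] of the
    second-order Taylor polynomial has derivative [o(|u - a|)] because the derivative of [F] is
    differentiable at [a]; the mean value estimate then gives a remainder [o(|w - a| ^ 2)], which
    survives the division by [w - a]. *)
Lemma derivable_dquot F a z : (\forall w \near a, derivable F w 1) ->
  derivable F z 1 -> derivable (dquot F a) z 1.
Proof.
move=> dFa dF; have [->|za] := eqVneq z a; last first.
  apply: (@near_eq_derivable _ _ _ (fun w => (F w - F a) / (w - a))); last first.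
    exact: derive_quotient_near.
  apply/near_normcP; exists (normc (z - a)); first by rewrite normc_gt0 subr_eq0.
  move=> w wz; rewrite /dquot; case: eqVneq => // wa.
  by move: wz; rewrite wa normcB ltxx.
have := derivableP (derivable_derive1 dFa); set l := derive _ _ _ => /is_derive_normcP dF1.
have [r r0 rF] := (near_normcP _ _).1 dFa.
suff [] : is_derive a 1 (dquot F a) (l / 2) by [].
apply/is_derive_normcP => e e0.
(* The half absorbs the factor 2 of [mean_value]. *)
have e20 : 0 < e / 2 by rewrite divr_gt0.
have [d d0 dP] := dF1 (e / 2) e20.
exists (Num.min r d); first by rewrite lt_min r0.
move=> w; rewrite lt_min => /andP[wr wd].
have [->|wa] := eqVneq w a.
  by rewrite !subrr mulr0 subrr Normc.normc0 mulr0.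
have wa0 : w - a != 0 by rewrite subr_eq0.
have Nwa : 0 < normc (w - a) by rewrite normc_gt0.
rewrite /dquot eqxx (negbTE wa).
set c := F^`()%classic a.
pose G u := F u - (F a + c * (u - a) + (l / 2) * (u - a) ^+ 2).
have E : (F w - F a) / (w - a) - c - l / 2 * (w - a) = (G w - G a) / (w - a).
  by rewrite /G; field.
rewrite E Normc.normcM Normc.normcV ler_pdivrMr//.
rewrite (_ : e * _ * _ = 2 * (e / 2 * normc (w - a)) * normc (w - a)); last by field.
apply: mean_value => t /andP[t0 t1].
set u := a + _.
have ua : u - a = t%:C * (w - a) by rewrite /u addrAC subrr add0r.
have Nu : normc (u - a) <= normc (w - a).
  by rewrite ua Normc.normcM normc_real ger0_norm// ler_piMl ?normc_ge0.
have dFu : derivable F u 1 by apply: rF; exact: le_lt_trans wr.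
have [dG eG] := is_deriveB (derivableP dFu) (is_derive_quadratic (F a) c (l / 2) a u).
split; first exact: dG.
rewrite derive1E; have -> : 'D_1 G u = F^`()%classic u - (c + 2 * (l / 2) * (u - a)).
  by rewrite derive1E; exact: eG.
rewrite (_ : _ - _ = F^`()%classic u - c - l * (u - a)); last by field.
apply: (le_trans (dP u (le_lt_trans Nu wd))).
by rewrite ler_wpM2l// ltW.
Qed.

End difference_quotient.

(** * Square integrability of a function with finite Dirichlet integral *)

Section square_integrable.
Variable R : realType.
Implicit Types (x y t K : R) (v z w : R[i]) (F G : R[i] -> R[i]).
Local Notation mu := (@lebesgue_measure R).
Local Notation mR := (measurableTypeR R).
Local Notation mR2 := (mR * mR)%type.

Definition holo F := forall z, disc R z -> derivable F z 1.

Definition L2 F :=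
  (\int[area R]_(p in planar_disc R) (normc (F (toC p)) ^+ 2)%:E < +oo)%E.

Lemma disc_near z : disc R z -> \forall w \near z, disc R w.
Proof. by move=> Dz; exact: (open_nbhs_nbhs (conj (@open_disc R) Dz)). Qed.

Lemma holo_near F z : holo F -> disc R z -> \forall w \near z, derivable F w 1.
Proof. by move=> hF /disc_near; apply: filterS => w; exact: hF. Qed.

Lemma holo_derive F : holo F -> holo F^`()%classic.
Proof. by move=> hF z Dz; apply: derivable_derive1; exact: holo_near. Qed.

Lemma holo_cts F : holo F -> cts_on (disc R) F.
Proof. by move=> hF z /hF; exact: derivable_cts. Qed.

Lemma cts_normc2 (T : topologicalType) (u : T -> R[i]) (t : T) :
  {for t, continuous u} -> {for t, continuous (fun s => normc (u s) ^+ 2 : R)}.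
Proof.
move=> /cts_ReIm[c1 c2].
have -> : (fun s => normc (u s) ^+ 2) = (fun s => Re (u s) * Re (u s) + Im (u s) * Im (u s)).
  by apply/funext => s; rewrite sqr_normcE !expr2.
by apply: continuousD; [exact: (continuousM c1 c1)|exact: (continuousM c2 c2)].
Qed.

Lemma measurable_normc2 F : cts_on (disc R) F ->
  measurable_fun (planar_disc R : set mR2) (fun p : mR2 => (normc (F (toC (p : R * R))) ^+ 2)%:E).
Proof.
move=> cF; apply/measurable_EFinP; apply: open_cts_measurable2; first exact: open_planar.
move=> p; rewrite inE => Dp; apply: cts_normc2.
exact: (cts_comp (@continuous_toC R p) (cF _ Dp)).
Qed.

Lemma areaX (A B : set mR) : measurable A -> measurable B ->
  area R (A `*` B) = (mu A * mu B)%E.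
Proof. by move=> mA mB; exact: product_measure1E. Qed.

Lemma area_disc_fin : (area R (planar_disc R) < +oo)%E.
Proof.
have sub : planar_disc R `<=` `[-1, 1]%classic `*` `[-1, 1]%classic.
  move=> [x y] /discE /= h; split; rewrite /= in_itv /= -ler_norml; apply: ltW.
    exact: le_lt_trans (normc_Re (x +i* y)) h.
  exact: le_lt_trans (normc_Im (x +i* y)) h.
apply: (@le_lt_trans _ _ (area R (`[-1, 1]%classic `*` `[-1, 1]%classic))).
  apply: le_measure => //; rewrite inE; first exact: measurable_planar.
  by apply: measurableX; exact: measurable_itv.
rewrite areaX; [|exact: measurable_itv..].
by rewrite !mu_itvcc ?ltry// lerNl (le_trans _ ler01)// lerN10.
Qed.

(** The constant term [k0] is allowed because the disc has finite area. Two dominating functions are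
    what multiplication by [z] and division by [z - a] call for: the function and its derivative. *)
Lemma L2_le F G H (k0 k1 k2 : R) :
  0 <= k0 -> 0 <= k1 -> 0 <= k2 ->
  cts_on (disc R) F -> cts_on (disc R) G -> cts_on (disc R) H ->
  (forall z, disc R z ->
    normc (F z) ^+ 2 <= k0 + k1 * normc (G z) ^+ 2 + k2 * normc (H z) ^+ 2) ->
  L2 G -> L2 H -> L2 F.
Proof.
move=> k00 k10 k20 cF cG cH le iG iH; rewrite /L2.
have mD := @measurable_planar R.
have mG := measurable_normc2 cG; have mH := measurable_normc2 cH.
have n0 (u : R[i]) : (0 <= (normc u ^+ 2)%:E)%E by rewrite lee_fin sqr_ge0.
have c0 (k : R) u : 0 <= k -> (0 <= k%:E * (normc u ^+ 2)%:E)%E.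
  by move=> k_ge0; rewrite mule_ge0.
have mk (k : R) g : measurable_fun (planar_disc R : set mR2) g ->
    measurable_fun (planar_disc R : set mR2) (fun p => k%:E * g p)%E.
  by move=> mg; exact: measurable_funeM.
apply: (@le_lt_trans _ _ (\int[area R]_(p in planar_disc R)
    (k0%:E + (k1%:E * (normc (G (toC p)) ^+ 2)%:E + k2%:E * (normc (H (toC p)) ^+ 2)%:E)))%E).
  apply: ge0_le_integral => //.
  - exact: measurable_normc2.
  - apply: emeasurable_funD; first exact: measurable_cst.
    by apply: emeasurable_funD; exact: mk.
  - by move=> p Dp; rewrite -!EFinM -!EFinD lee_fin addrA; exact: le.
have mkG := mk k1 _ mG; have mkH := mk k2 _ mH.
have mGH := emeasurable_funD mkG mkH.
have pG p : planar_disc R p -> (0 <= k1%:E * (normc (G (toC p)) ^+ 2)%:E)%E.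
  by move=> _; exact: c0.
have pH p : planar_disc R p -> (0 <= k2%:E * (normc (H (toC p)) ^+ 2)%:E)%E.
  by move=> _; exact: c0.
have pGH p : planar_disc R p ->
    (0 <= k1%:E * (normc (G (toC p)) ^+ 2)%:E + k2%:E * (normc (H (toC p)) ^+ 2)%:E)%E.
  by move=> Dp; rewrite adde_ge0 ?pG ?pH.
rewrite ge0_integralD// integral_cst// ge0_integralD//.
rewrite !ge0_integralZl_EFin//.
apply: lte_add_pinfty; first by apply: lte_mul_pinfty; rewrite ?lee_fin//; exact: area_disc_fin.
by apply: lte_add_pinfty; apply: lte_mul_pinfty; rewrite ?lee_fin.
Qed.

Lemma segment_increment F (p v : R[i]) (a b : R) : holo F -> normc v = 1 ->
  a < b -> b - a <= 1 -> (forall t, a <= t <= b -> disc R (p + t%:C * v)) ->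
  ((normc (F (p + b%:C * v) - F (p + a%:C * v)) ^+ 2)%:E <=
   2%:E * (\int[mu]_(t in `[a, b]) (normc (F^`()%classic (p + t%:C * v)) ^+ 2)%:E + 1))%E.
Proof.
move=> hF v1 ab ab1 Dt.
have hF' := holo_derive hF.
have cline t : {for t, continuous (fun s : R => p + s%:C * v)}.
  move=> A /nbhs_complexP[r r0 rA]; apply/nbhs_ballP; exists r => // s.
  rewrite /ball /= => ts; apply: rA.
  by rewrite opprD addrACA subrr add0r -mulrBl -rmorphB Normc.normcM v1 mulr1 normc_real.
have cF' : ctsab a b (fun t => F^`()%classic (p + t%:C * v)).
  by move=> t tab; exact: (cts_comp (cline t) (holo_cts hF' (Dt t tab))).
have mI : measurable (`[a, b]%classic : set mR) by exact: measurable_itv.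
have mF' : measurable_fun (`[a, b]%classic : set mR)
    (fun t => (normc (F^`()%classic (p + t%:C * v)) ^+ 2)%:E).
  apply: (measurable_int mu); apply: (@ctsab_integrable _ a b (fun t => normc _ ^+ 2)).
  by move=> t tab; apply: cts_normc2; exact: cF'.
have part L : real_part_like L -> (forall z, {for z, continuous L}) ->
  (((L (F (p + b%:C * v)) - L (F (p + a%:C * v))) ^+ 2)%:E <=
   \int[mu]_(t in `[a, b]) (normc (F^`()%classic (p + t%:C * v)) ^+ 2)%:E + 1)%E.
  move=> LL cL; have [_ _ LN] := LL.
  have cdu : ctsab a b (fun t => L (F^`()%classic (p + t%:C * v) * v)).
    move=> t tab.
    have cv : {for (F^`()%classic (p + t%:C * v)), continuous (fun z : R[i] => z * v)}.
      by apply: ctsM; [exact: cvg_id|exact: cst_continuous].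
    exact: (cts_comp (cts_comp (cF' t tab) cv) (cL _)).
  apply: le_trans; first apply: (@sqr_increment_le _ (fun s => L (F (p + s%:C * v)))
    (fun t => L (F^`()%classic (p + t%:C * v) * v)) a b ab ab1).
  - by move=> t tab; apply: is_derive_line => //; apply: hF; exact: Dt.
  - exact: cdu.
  rewrite leeD2r//; apply: ge0_le_integral => //.
  - by move=> t _; rewrite lee_fin sqr_ge0.
  - apply: (measurable_int mu); apply: (@ctsab_integrable _ a b (fun t => L _ ^+ 2)).
    move=> t tab; have -> : (fun t => L (F^`()%classic (p + t%:C * v) * v) ^+ 2) =
       (fun t => L (F^`()%classic (p + t%:C * v) * v) * L (F^`()%classic (p + t%:C * v) * v)).
      by apply/funext => s; rewrite expr2.
    exact: (@continuousM _ _ _ _ t (cdu t tab) (cdu t tab)).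
  - move=> t _; rewrite lee_fin -real_normK ?num_real// ler_pXn2r ?nnegrE ?normr_ge0 ?normc_ge0//.
    by apply: (le_trans (LN _)); rewrite Normc.normcM v1 mulr1.
rewrite sqr_normcE ReD ReN ImD ImN EFinD.
set I := (\int[_]_(_ in _) _ + 1)%E.
have -> : (2%:E * I = I + I)%E by rewrite mule_natl mule2n.
apply: leeD; first exact: (part _ (@Re_part_like R) (@cts_Re R)).
exact: (part _ (@Im_part_like R) (@cts_Im R)).
Qed.

End square_integrable.

(** * Bounding a function by its energy along chords *)

Section poincare.
Variable R : realType.
Implicit Types (x y t K : R) (v z w q : R[i]) (F : R[i] -> R[i]).
Local Notation mu := (@lebesgue_measure R).
Local Notation mR := (measurableTypeR R).
Local Notation mR2 := (mR * mR)%type.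

(** The extension by 0 lets slices run over whole lines, the form to which Tonelli's theorem
    applies. *)
Definition energy F : R[i] -> \bar R :=
  (fun z => (normc (F^`()%classic z) ^+ 2)%:E) \_ (disc R).

Lemma energy_ge0 F z : (0 <= energy F z)%E.
Proof. by rewrite /energy patchE; case: ifP => // _; rewrite lee_fin sqr_ge0. Qed.

Lemma disc_convex z w t : disc R z -> disc R w -> 0 <= t <= 1 ->
  disc R (z + t%:C * (w - z)).
Proof.
move=> /discE z1 /discE w1 /andP[t0 t1]; apply/discE.
have -> : z + t%:C * (w - z) = (1 - t)%:C * z + t%:C * w by rewrite rmorphB rmorph1; ring.
apply: (le_lt_trans (le_normcD _ _)).
rewrite !Normc.normcM !normc_real !ger0_norm ?subr_ge0//.
have [->|tn0] := eqVneq t 0; first by rewrite subr0 mul1r mul0r addr0.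
have h : t * normc w < t * 1 by rewrite ltr_pM2l// lt_def tn0.
have : (1 - t) * normc z <= (1 - t) * 1 by rewrite ler_wpM2l ?subr_ge0// ltW.
lra.
Qed.

Lemma sqr_normc_leB z w : normc z ^+ 2 <= 2 * normc w ^+ 2 + 2 * normc (z - w) ^+ 2.
Proof.
have h : normc z <= normc w + normc (z - w) by have := le_normcD w (z - w); rewrite addrC subrK.
apply: (@le_trans _ _ ((normc w + normc (z - w)) ^+ 2)).
  by rewrite ler_pXn2r ?nnegrE ?addr_ge0 ?normc_ge0.
by rewrite -subr_ge0 (_ : _ - _ = (normc w - normc (z - w)) ^+ 2) ?sqr_ge0//; ring.
Qed.

(** By convexity the chord from [q] stays in the disc. The constants come from [|F(q + t v)| ^ 2 <=
    2 K ^ 2 + 2 |increment| ^ 2], where the squared increment is at most [2 * (I + 1)]. *)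
Lemma slice_bound F q v t K : holo F -> normc v = 1 -> `|t| <= 1 ->
  disc R q -> disc R (q + t%:C * v) -> normc (F q) <= K ->
  measurable_fun [set: mR] (fun s : mR => energy F (q + s%:C * v)) ->
  ((normc (F (q + t%:C * v)) ^+ 2)%:E <=
    (2 * K ^+ 2 + 4)%:E + 4%:E * \int[mu]_s energy F (q + s%:C * v)%R)%E.
Proof.
move=> hF v1 t1 Dq Dqt FK mE.
set I := (\int[mu]_s _)%E.
have I0 : (0 <= I)%E by apply: integral_ge0 => s _; exact: energy_ge0.
have K2 : normc (F q) ^+ 2 <= K ^+ 2.
  by rewrite ler_pXn2r ?nnegrE ?normc_ge0// (le_trans _ FK) ?normc_ge0.
have seg s a b : a <= s <= b -> a < b -> (a = 0 /\ b = t) \/ (a = t /\ b = 0) ->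
    disc R (q + s%:C * v).
  move=> /andP[s0 st] ab ts; have tn0 : t != 0 by case: ts => -[ea eb]; apply/eqP; lra.
  have := @disc_convex q (q + t%:C * v) (s / t) Dq Dqt.
  rewrite addrAC subrr add0r mulrA -rmorphM divfK//; apply.
  case: ts => -[ea eb].
    have t0 : 0 < t by lra.
    by rewrite divr_ge0/= ?ler_pdivrMr ?mul1r//; lra.
  have t0 : t < 0 by lra.
  by rewrite -mulrNN -invrN divr_ge0/= ?ler_pdivrMr ?mul1r ?oppr_gt0//; lra.
have sub a b : a < b -> (a = 0 /\ b = t) \/ (a = t /\ b = 0) ->
    (\int[mu]_(s in `[a, b]) (normc (F^`()%classic (q + s%:C * v)%R) ^+ 2)%:E <= I)%E.
  move=> ab abt; apply: (@le_trans _ _ (\int[mu]_(s in `[a, b]) energy F (q + s%:C * v)%R)%E).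
    rewrite le_eqVlt; apply/orP; left; apply/eqP; apply: eq_integral => s.
    rewrite inE /= in_itv /= => sab; rewrite /energy patchE ifT// inE.
    exact: seg sab ab abt.
  by apply: ge0_subset_integral => // s _; exact: energy_ge0.
have incr : ((normc (F (q + t%:C * v) - F q) ^+ 2)%:E <= 2%:E * (I + 1))%E.
  have [t0|t0|->] := ltgtP t 0.
  - have := @segment_increment _ F q v t 0 hF v1 t0.
    rewrite sub0r -(ltr0_norm t0) => /(_ t1) H.
    have := H (fun s h => @seg s t 0 h t0 (or_intror (conj erefl erefl))).
    rewrite rmorph0 mul0r addr0 normcB => /le_trans; apply.
    by apply: lee_wpmul2l => //; apply: leeD2r; apply: sub => //; right.
  - have := @segment_increment _ F q v 0 t hF v1 t0.
    rewrite subr0 -{1}(gtr0_norm t0) => /(_ t1) H.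
    have := H (fun s h => @seg s 0 t h t0 (or_introl (conj erefl erefl))).
    rewrite rmorph0 mul0r addr0 => /le_trans; apply.
    by apply: lee_wpmul2l => //; apply: leeD2r; apply: sub => //; left.
  - rewrite rmorph0 mul0r addr0 subrr Normc.normc0 expr0n /=.
    by rewrite mule_ge0// adde_ge0.
apply: (@le_trans _ _ ((2 * K ^+ 2)%:E + 2%:E * (normc (F (q + t%:C * v) - F q) ^+ 2)%:E)%E).
  rewrite -EFinM -EFinD lee_fin; apply: (le_trans (sqr_normc_leB _ (F q))).
  by rewrite lerD2r ler_pM2l.
rewrite [X in (_ <= X + _)%E]EFinD -addeA leeD2l//.
apply: (@le_trans _ _ (2%:E * (2%:E * (I + 1)))%E); first exact: lee_wpmul2l.
rewrite muleA -EFinM muleDr// ?ge0_adde_def ?inE//.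
by rewrite mule1 addeC (_ : 2 * 2 = 4 :> R)//; ring.
Qed.

End poincare.

Section poincare_disc.
Variable R : realType.
Implicit Types (x y t K : R) (v z w q : R[i]) (F : R[i] -> R[i]).
Local Notation mu := (@lebesgue_measure R).
Local Notation mR := (measurableTypeR R).
Local Notation mR2 := (mR * mR)%type.

Lemma measurable_energy F : holo F ->
  measurable_fun [set: mR2] (fun p : mR2 => energy F (toC (p : R * R))).
Proof.
move=> hF; apply/(measurable_restrictT _ (@measurable_planar R)).
by apply: measurable_normc2; exact: holo_cts (holo_derive hF).
Qed.

Lemma segment_bounded (u : R -> R[i]) (a b : R) : a <= b -> ctsab a b u ->
  exists K, forall t, a <= t <= b -> normc (u t) <= K.
Proof.
move=> ab cu.
have [|c cab cmax] := @EVT_max R (fun t => normc (u t) ^+ 2) a b ab.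
  apply: continuous_in_subspaceT => t; rewrite inE /= in_itv /= => tab.
  by apply: cts_normc2; exact: cu.
exists (normc (u c)) => t tab; rewrite -(@ler_pXn2r _ 2) ?nnegrE ?normc_ge0//.
by apply: cmax; rewrite in_itv.
Qed.

(** The value 4/5 exceeds the inverse square root of 2, so both coordinates cannot exceed it; it is
    below 1, so the corresponding segments of the axes are compact in the disc. *)
Lemma disc_coordinates x y : x ^+ 2 + y ^+ 2 < 1 ->
  [/\ `|x| <= 1, `|y| <= 1 & `|x| <= 4 / 5 \/ `|y| <= 4 / 5].
Proof.
rewrite -[x ^+ 2]real_normK ?num_real// -[y ^+ 2]real_normK ?num_real// => xy.
have [x0 y0] : 0 <= `|x| /\ 0 <= `|y| by [].
move: `|x| `|y| x0 y0 xy => {}x {}y x0 y0 xy.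
have H (a b : R) : 0 <= a -> 0 <= b -> a ^+ 2 + b ^+ 2 < 1 -> a <= 1.
  move=> a0 b0 ab; rewrite leNgt; apply/negP => a1.
  have : 1 ^+ 2 < a ^+ 2 by rewrite ltr_pXn2r ?nnegrE.
  by have := sqr_ge0 b; rewrite expr1n; lra.
split; [exact: H xy|by apply: (H y x) => //; rewrite addrC|].
have [|x4] := leP x (4 / 5); [by left|right].
rewrite leNgt; apply/negP => y4.
have h (a : R) : 4 / 5 < a -> 1 / 2 < a ^+ 2.
  move=> a4; apply: (@lt_trans _ _ ((4 / 5) ^+ 2)); first by rewrite expr2; lra.
  by rewrite ltr_pXn2r ?nnegrE//; lra.
have := h x x4; have := h y y4; lra.
Qed.

Lemma disc_sqr x y : disc R (x +i* y) <-> x ^+ 2 + y ^+ 2 < 1.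
Proof.
split=> [/discE h|h].
  have : normc (x +i* y) ^+ 2 < 1 by rewrite expr_lt1 ?normc_ge0.
  by rewrite sqr_normcE.
by apply/discE; rewrite -(@expr_lt1 _ 2) ?normc_ge0// sqr_normcE.
Qed.

Definition hslice F y : \bar R := (\int[mu]_x energy F (x +i* y))%E.
Definition vslice F x : \bar R := (\int[mu]_y energy F (x +i* y))%E.

Lemma measurable_hslice F : holo F -> measurable_fun [set: mR] (hslice F).
Proof.
move=> hF; apply: (@measurable_fun_fubini_tonelli_G _ _ _ _ _ mu _ (measurable_energy hF)).
by move=> p; exact: energy_ge0.
Qed.

Lemma measurable_vslice F : holo F -> measurable_fun [set: mR] (vslice F).
Proof.
move=> hF; apply: (@measurable_fun_fubini_tonelli_F _ _ _ _ _ mu _ (measurable_energy hF)).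
by move=> p; exact: energy_ge0.
Qed.

Lemma integral_hslice F : holo F -> (\int[mu]_y hslice F y =
  \int[area R]_(p in planar_disc R) (normc (F^`()%classic (toC p)) ^+ 2)%:E)%E.
Proof.
move=> hF; rewrite [RHS]integral_mkcond.
have := @fubini_tonelli2 _ _ _ _ _ mu mu _ (measurable_energy hF).
by move=> <-// p; exact: energy_ge0.
Qed.

Lemma integral_vslice F : holo F -> (\int[mu]_x vslice F x =
  \int[area R]_(p in planar_disc R) (normc (F^`()%classic (toC p)) ^+ 2)%:E)%E.
Proof.
move=> hF; rewrite [RHS]integral_mkcond.
have := @fubini_tonelli1 _ _ _ _ _ mu mu _ (measurable_energy hF).
by move=> <-// p; exact: energy_ge0.
Qed.

(* The strips [|x| <= 4/5] and [|y| <= 4/5] cover the disc, and the points of the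
   axes they contain form compact segments on which [F] is bounded. *)
Lemma holo_slice_bound F : holo F -> exists2 C : R, 0 <= C & forall x y, disc R (x +i* y) ->
  ((normc (F (x +i* y)) ^+ 2)%:E <= C%:E + (4%:E * hslice F y + 4%:E * vslice F x))%E.
Proof.
move=> hF.
have h45 : - (4 / 5) <= 4 / 5 :> R by lra.
have in45 t : - (4 / 5) <= t <= 4 / 5 -> disc R (0 +i* t) /\ disc R (t +i* 0).
  rewrite -ler_norml => ht; have t2 : t ^+ 2 < 1.
    by rewrite -real_normK ?num_real// expr_lt1//; lra.
  by split; apply/disc_sqr; rewrite expr0n /= ?add0r ?addr0.
have [|K1 K1P] := @segment_bounded (fun t => F (0 +i* t)) _ _ h45.
  by move=> t /in45[D _]; apply: cts_vline; exact: holo_cts.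
have [|K2 K2P] := @segment_bounded (fun t => F (t +i* 0)) _ _ h45.
  by move=> t /in45[_ D]; apply: cts_hline; exact: holo_cts.
have hs0 y : (0 <= hslice F y)%E by apply: integral_ge0 => s _; exact: energy_ge0.
have vs0 x : (0 <= vslice F x)%E by apply: integral_ge0 => s _; exact: energy_ge0.
have C1 (K : R) : 0 <= 2 * K ^+ 2 + 4 by rewrite addr_ge0// mulr_ge0// sqr_ge0.
exists ((2 * K1 ^+ 2 + 4) + (2 * K2 ^+ 2 + 4)); first exact: addr_ge0.
move=> x y Dxy; have /disc_sqr/disc_coordinates[x1 y1 [x4|y4]] := Dxy.
- have x4' : - (4 / 5) <= x <= 4 / 5 by rewrite -ler_norml.
  have E s : x +i* s = (x +i* 0) + s%:C * 'i by apply/complexP => /=; ring.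
  have := @slice_bound _ F (x +i* 0) 'i y K2 hF (normc_i _) y1 (in45 x x4').2.
  rewrite -E => /(_ Dxy (K2P x x4')).
  have -> : (fun s : mR => energy F (x +i* 0 + s%:C * 'i)) = (fun s : mR => energy F (x +i* s)).
    by apply/funext => s; rewrite -E.
  move=> /(_ _)H; apply: le_trans; first apply: H.
    exact: (measurableT_comp (measurable_energy hF) (measurable_pair1 x)).
  apply: leeD; first by rewrite lee_fin lerDr.
  apply: leeDr; apply: mule_ge0; [by rewrite lee_fin|exact: hs0].
- have y4' : - (4 / 5) <= y <= 4 / 5 by rewrite -ler_norml.
  have E s : s +i* y = (0 +i* y) + s%:C * 1 by apply/complexP => /=; ring.
  have := @slice_bound _ F (0 +i* y) 1 x K1 hF (Normc.normc1 _) x1 (in45 y y4').1.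
  rewrite -E => /(_ Dxy (K1P y y4')).
  have -> : (fun s : mR => energy F (0 +i* y + s%:C * 1)) = (fun s : mR => energy F (s +i* y)).
    by apply/funext => s; rewrite -E.
  move=> /(_ _)H; apply: le_trans; first apply: H.
    exact: (measurableT_comp (measurable_energy hF) (measurable_pair2 y)).
  apply: leeD; first by rewrite lee_fin lerDl.
  apply: leeDl; apply: mule_ge0; [by rewrite lee_fin|exact: vs0].
Qed.

(** A function of one coordinate is not integrable over the plane unless it vanishes almost
    everywhere; cutting off the other coordinate at the square around the disc costs only its side
    length 2. *)
Lemma integral_indic_slice (g : mR -> \bar R) : measurable_fun [set: mR] g ->
  (forall y, 0 <= g y)%E ->
  (\int[area R]_p ((\1_(`[(-1 : R), 1]%classic) p.1)%:E * g p.2) = 2%:E * \int[mu]_y g y)%E /\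
  (\int[area R]_p ((\1_(`[(-1 : R), 1]%classic) p.2)%:E * g p.1) = 2%:E * \int[mu]_y g y)%E.
Proof.
move=> mg g0.
have m1 : measurable_fun [set: mR] (fun x : mR => (\1_(`[(-1 : R), 1]%classic) x : R)%:E).
  by apply/measurable_EFinP; apply: measurable_indic; exact: measurable_itv.
have i1 : (\int[mu]_x (\1_(`[(-1 : R), 1]%classic) x)%:E = 2%:E)%E.
  rewrite integral_indic//= setIT mu_itvcc; first by congr EFin; ring.
  by lra.
have n1 x : [set: mR] x -> (0 <= (\1_(`[(-1 : R), 1]%classic) x : R)%:E)%E.
  by move=> _; rewrite lee_fin.
have sl y : (\int[mu]_x ((\1_(`[(-1 : R), 1]%classic) x)%:E * g y) = 2%:E * g y)%E.
  by rewrite ge0_integralZr// i1.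
split.
  have mh : measurable_fun [set: mR2]
      (fun p : mR2 => (\1_(`[(-1 : R), 1]%classic) (p.1 : R))%:E * g p.2)%E.
    apply: emeasurable_funM; first exact: (measurableT_comp m1 measurable_fst).
    exact: (measurableT_comp mg measurable_snd).
  rewrite /area (@fubini_tonelli2 _ _ _ _ _ mu mu _ mh); last first.
    by move=> p; rewrite mule_ge0// lee_fin.
  rewrite /fubini_G /=; under eq_integral do rewrite sl.
  by rewrite ge0_integralZl.
have mh : measurable_fun [set: mR2]
    (fun p : mR2 => (\1_(`[(-1 : R), 1]%classic) (p.2 : R))%:E * g p.1)%E.
  apply: emeasurable_funM; first exact: (measurableT_comp m1 measurable_snd).
  exact: (measurableT_comp mg measurable_fst).
rewrite /area (@fubini_tonelli1 _ _ _ _ _ mu mu _ mh); last first.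
  by move=> p; rewrite mule_ge0// lee_fin.
rewrite /fubini_F /=; under eq_integral do rewrite sl.
by rewrite ge0_integralZl.
Qed.

Let I1 : set R := `[-1, 1]%classic.

Lemma integral_disc_slices (g1 g2 : mR -> \bar R) (C : R) : 0 <= C ->
  measurable_fun [set: mR] g1 -> measurable_fun [set: mR] g2 ->
  (forall y, 0 <= g1 y)%E -> (forall y, 0 <= g2 y)%E ->
  (\int[mu]_y g1 y < +oo)%E -> (\int[mu]_y g2 y < +oo)%E ->
  let h (p : mR2) := (C%:E + (4%:E * ((\1_I1 p.1)%:E * g1 p.2) +
     4%:E * ((\1_I1 p.2)%:E * g2 p.1)))%E in
  measurable_fun (planar_disc R : set mR2) h /\
  (\int[area R]_(p in planar_disc R) h p < +oo)%E.
Proof.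
move=> C0 mg1 mg2 g10 g20 f1 f2.
have mD := @measurable_planar R.
have m1 : measurable_fun [set: mR] (fun x : mR => (\1_I1 x : R)%:E).
  by apply/measurable_EFinP; apply: measurable_indic; exact: measurable_itv.
pose h1 (p : mR2) : \bar R := ((\1_I1 p.1)%:E * g1 p.2)%E.
pose h2 (p : mR2) : \bar R := ((\1_I1 p.2)%:E * g2 p.1)%E.
have mh1 : measurable_fun [set: mR2] h1.
  apply: emeasurable_funM; first exact: (measurableT_comp m1 measurable_fst).
  exact: (measurableT_comp mg1 measurable_snd).
have mh2 : measurable_fun [set: mR2] h2.
  apply: emeasurable_funM; first exact: (measurableT_comp m1 measurable_snd).
  exact: (measurableT_comp mg2 measurable_fst).
have p1 p : (0 <= h1 p)%E by rewrite /h1 mule_ge0// lee_fin.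
have p2 p : (0 <= h2 p)%E by rewrite /h2 mule_ge0// lee_fin.
have {}f1 : (\int[area R]_(p in planar_disc R) h1 p < +oo)%E.
  apply: (@le_lt_trans _ _ (\int[area R]_p h1 p)%E).
    by apply: ge0_subset_integral.
  rewrite /h1 (integral_indic_slice mg1 g10).1.
  by apply: lte_mul_pinfty => //; rewrite lee_fin.
have {}f2 : (\int[area R]_(p in planar_disc R) h2 p < +oo)%E.
  apply: (@le_lt_trans _ _ (\int[area R]_p h2 p)%E).
    by apply: ge0_subset_integral.
  rewrite /h2 (integral_indic_slice mg2 g20).2.
  by apply: lte_mul_pinfty => //; rewrite lee_fin.
rewrite -/h1 -/h2.
have q1 p : (0 <= 4%:E * h1 p)%E by rewrite mule_ge0.
have q2 p : (0 <= 4%:E * h2 p)%E by rewrite mule_ge0.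
have mq1 : measurable_fun (planar_disc R : set mR2) (fun p => 4%:E * h1 p)%E.
  by apply: measurable_funTS; exact: measurable_funeM.
have mq2 : measurable_fun (planar_disc R : set mR2) (fun p => 4%:E * h2 p)%E.
  by apply: measurable_funTS; exact: measurable_funeM.
have q12 p : (0 <= 4%:E * h1 p + 4%:E * h2 p)%E by rewrite adde_ge0.
have mq12 := emeasurable_funD mq1 mq2.
have mc : measurable_fun (planar_disc R : set mR2) (fun=> C%:E) by exact: measurable_cst.
split; first exact: (emeasurable_funD mc mq12).
rewrite -[X in (X < _)%E]/(\int[area R]_(p in planar_disc R)
    (C%:E + (4%:E * h1 p + 4%:E * h2 p)))%E.
have mh1' := measurable_funTS (D := planar_disc R : set mR2) mh1.
have mh2' := measurable_funTS (D := planar_disc R : set mR2) mh2.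
rewrite ge0_integralD// integral_cst// ge0_integralD//.
rewrite !ge0_integralZl_EFin//.
apply: lte_add_pinfty; first by apply: lte_mul_pinfty; rewrite ?lee_fin//; exact: area_disc_fin.
by apply: lte_add_pinfty; apply: lte_mul_pinfty; rewrite ?lee_fin.
Qed.

(** Integrate [holo_slice_bound] over the disc: by Tonelli both slice functions have integral equal
    to the energy of [F], and the cutoffs equal 1 on the disc. *)
Theorem L2_of_derive F : holo F -> L2 F^`()%classic -> L2 F.
Proof.
move=> hF iF'; have [C C0 bound] := holo_slice_bound hF.
have G (a b : R) (X A B : \bar R) : a = 1 -> b = 1 ->
    (X <= C%:E + (4%:E * A + 4%:E * B) ->
     X <= C%:E + (4%:E * (a%:E * A) + 4%:E * (b%:E * B)))%E.
  by move=> -> ->; rewrite !mul1e.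
have [||||mh hfin] := integral_disc_slices C0 (measurable_hslice hF) (measurable_vslice hF).
- by move=> y; apply: integral_ge0 => s _; exact: energy_ge0.
- by move=> y; apply: integral_ge0 => s _; exact: energy_ge0.
- by rewrite integral_hslice.
- by rewrite integral_vslice.
- apply: le_lt_trans hfin; apply: ge0_le_integral.
  + exact: measurable_planar.
  + by move=> p _; rewrite lee_fin sqr_ge0.
  + by apply: measurable_normc2; exact: holo_cts.
  + exact: mh.
  + move=> [x y] Dp.
    have /disc_sqr/disc_coordinates[x1 y1 _] := Dp.
    have in1 t : `|t| <= 1 -> (\1_I1 t : R) = 1.
      by move=> t1; rewrite indicE mem_set// /I1 /= in_itv /= -ler_norml.
    exact: (G _ _ _ _ _ (in1 x x1) (in1 y y1) (bound x y Dp)).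
Qed.

End poincare_disc.

(** * Multiplication by [z] and division by [z - a] *)

Section dirichlet_operations.
Variable R : realType.
Implicit Types (a z w : R[i]) (F G : R[i] -> R[i]).

Lemma derive1_mulc F G z : derivable F z 1 -> derivable G z 1 ->
  (fun w => F w * G w)^`()%classic z = F z * G^`()%classic z + F^`()%classic z * G z.
Proof.
move=> dF dG; rewrite !derive1E (@deriveM _ _ F G z 1 dF dG) -![_ *: _]/(_ * _).
by rewrite [G z * _]mulrC.
Qed.

Lemma derive1_shift (c : R[i]) z : (fun w : R[i] => w - c)^`()%classic z = 1.
Proof.
rewrite derive1E (@deriveB _ _ _ (fun w : R[i] => w) (fun=> c) z 1).
- by rewrite derive_cst subr0 derive_id.
- exact: derivable_id.
- exact: derivable_cst.
Qed.

Lemma derivable_shift (c : R[i]) z : derivable (fun w : R[i] => w - c) z 1.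
Proof. by apply: derivableB; [exact: derivable_id|exact: derivable_cst]. Qed.

Lemma holo_mulX F : holo F -> holo (fun z => z * F z).
Proof.
move=> hF z Dz; apply: derivable_mulc; first exact: derivable_id.
exact: hF.
Qed.

Lemma sqr_normcD_le z w : normc (z + w) ^+ 2 <= 2 * normc z ^+ 2 + 2 * normc w ^+ 2.
Proof. by have := sqr_normc_leB (z + w) z; rewrite [z + w]addrC addrK addrC. Qed.

Lemma L2_mulX F : holo F -> L2 F^`()%classic -> L2 (fun z => z * F z)^`()%classic.
Proof.
move=> hF iF'; have iF := L2_of_derive hF iF'.
have hX := holo_mulX hF; have hF' := holo_derive hF.
apply: (@L2_le _ _ F^`()%classic F 0 2 2 _ _ _ (holo_cts (holo_derive hX))
  (holo_cts hF') (holo_cts hF) _ iF' iF) => [||| z Dz].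
- exact: lexx.
- exact: ler0n.
- exact: ler0n.
- rewrite (derive1_mulc (F := id) (@derivable_id _ _ z 1) (hF z Dz)).
  have -> : (id : R[i] -> R[i])^`()%classic z = 1 by rewrite derive1E derive_id.
  rewrite mul1r add0r.
  apply: (le_trans (sqr_normcD_le _ _)); rewrite lerD2r ler_pM2l//.
  rewrite Normc.normcM exprMn; apply: ler_piMl; first by rewrite sqr_ge0.
  by rewrite expr_le1 ?normc_ge0//; move/discE: Dz => /ltW.
Qed.

Lemma holo_dquot F a : holo F -> disc R a -> holo (dquot F a).
Proof.
move=> hF Da z Dz; apply: derivable_dquot; last exact: hF.
exact: holo_near.
Qed.

Lemma derive1_dquot F a z : holo F -> disc R a -> disc R z -> z != a ->
  (dquot F a)^`()%classic z = (F^`()%classic z - dquot F a z) / (z - a).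
Proof.
move=> hF Da Dz za; have hq := holo_dquot hF Da.
have dm := derivable_mulc (@derivable_shift a z) (hq z Dz).
have E : F = (fun w => (w - a) * dquot F a w - (- F a)).
  by apply/funext => w; rewrite {1}(dquotP F a w) opprK addrC.
have : F^`()%classic z = (z - a) * (dquot F a)^`()%classic z + dquot F a z.
  rewrite {1}E derive1E (@deriveB _ _ _ (fun w => (w - a) * dquot F a w) (fun=> - F a) z 1).
  - by rewrite derive_cst subr0 -derive1E (derive1_mulc (@derivable_shift a z) (hq z Dz))
      derive1_shift mul1r.
  - exact: dm.
  - exact: derivable_cst.
by move=> ->; rewrite addrK mulrC mulKf// subr_eq0.
Qed.

(** Near [a] the derivative of the quotient is bounded by continuity. At distance at least [d] from
    [a] it equals [(F' - q) / (z - a)], where the denominator costs a factor [d^-1]. *)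
Lemma L2_dquot F a : holo F -> disc R a -> L2 F^`()%classic -> L2 (dquot F a)^`()%classic.
Proof.
have close (x M A G H : R) : x <= M -> 0 <= A -> 0 <= G -> 0 <= H -> x <= M + A + G + H.
  by lra.
have away (g r f fa e M : R) : 0 <= M -> r * e <= (2 * f + 2 * fa) * e * e ->
    (2 * g + 2 * r) * e <= M + 4 * (e * e) * fa + 2 * e * g + 4 * (e * e) * f.
  by lra.
move=> hF Da iF'; have iF := L2_of_derive hF iF'.
have hq := holo_dquot hF Da; have hq' := holo_derive hq; have hF' := holo_derive hF.
have /cts_normcP/(_ 1 ltr01)[d d0 dP] := holo_cts hq' Da.
set q := dquot F a in hq hq' dP *.
have di0 : 0 < d^-1 by rewrite invr_gt0.
pose M := (normc (q^`()%classic a) + 1) ^+ 2.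
have M0 : 0 <= M by exact: sqr_ge0.
(* [M] serves near [a]. Away from it, [|u - v| ^ 2 <= 2 |u| ^ 2 + 2 |v| ^ 2] is used twice, once for
   the derivative of [q] and once for [q]; hence the factors 2 and 4 and the powers of [d^-1]. *)
pose k0 := M + 4 * d^-1 ^+ 4 * normc (F a) ^+ 2.
pose k1 := 2 * d^-1 ^+ 2.
pose k2 := 4 * d^-1 ^+ 4.
have k10 : 0 <= k1 by rewrite /k1 mulr_ge0// exprn_ge0// ltW.
have k20 : 0 <= k2 by rewrite /k2 mulr_ge0// exprn_ge0// ltW.
have kF0 : 0 <= k2 * normc (F a) ^+ 2 by rewrite mulr_ge0// sqr_ge0.
apply: (@L2_le _ _ F^`()%classic F k0 k1 k2 (addr_ge0 M0 kF0) k10 k20 (holo_cts hq')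
  (holo_cts hF') (holo_cts hF) _ iF' iF) => z Dz.
have [zd|zd] := ltP (normc (z - a)) d.
  have h1 : normc (q^`()%classic z) <= normc (q^`()%classic a) + 1.
    have := le_normcD (q^`()%classic z - q^`()%classic a) (q^`()%classic a).
    by rewrite subrK => /le_trans; apply; rewrite addrC lerD2l; exact: ltW (dP z zd).
  have h2 : normc (q^`()%classic z) ^+ 2 <= M.
    by rewrite ler_pXn2r ?nnegrE ?normc_ge0// addr_ge0 ?normc_ge0.
  have h3 : 0 <= k1 * normc (F^`()%classic z) ^+ 2 by rewrite mulr_ge0// sqr_ge0.
  have h4 : 0 <= k2 * normc (F z) ^+ 2 by rewrite mulr_ge0// sqr_ge0.
  exact: close.
have za : z != a.
  by apply/eqP => za; move: zd; rewrite za subrr Normc.normc0 leNgt d0.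
have iz : normc (z - a)^-1 ^+ 2 <= d^-1 ^+ 2.
  rewrite ler_pXn2r ?nnegrE ?normc_ge0 ?(ltW di0)// Normc.normcV lef_pV2 ?posrE//.
  exact: lt_le_trans zd.
have quo (u v : R[i]) : normc ((u - v) / (z - a)) ^+ 2 <=
    (2 * normc u ^+ 2 + 2 * normc v ^+ 2) * d^-1 ^+ 2.
  rewrite Normc.normcM exprMn ler_pM ?sqr_ge0//.
  by have := sqr_normcD_le u (- v); rewrite normcN.
have qz : normc (q z) ^+ 2 <= (2 * normc (F z) ^+ 2 + 2 * normc (F a) ^+ 2) * d^-1 ^+ 2.
  by rewrite /q /dquot (negbTE za); exact: quo.
rewrite (derive1_dquot hF Da Dz za); apply: (le_trans (quo _ _)).
have D2 : 0 <= d^-1 ^+ 2 by rewrite exprn_ge0// ltW.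
have : normc (q z) ^+ 2 * d^-1 ^+ 2 <=
    (2 * normc (F z) ^+ 2 + 2 * normc (F a) ^+ 2) * d^-1 ^+ 2 * d^-1 ^+ 2.
  by rewrite ler_wpM2r.
rewrite /k0 /k1 /k2 (_ : d^-1 ^+ 4 = d^-1 ^+ 2 * d^-1 ^+ 2); last by rewrite -exprD.
exact: away.
Qed.

End dirichlet_operations.

(** * The image of a Dirichlet function omits two values *)

Section dyadic.
Variable R : realType.
Implicit Types (x y : R) (p q : R * R) (n m : nat) (i j : int).
Local Notation mu := (@lebesgue_measure R).
Local Notation mR := (measurableTypeR R).
Local Notation mR2 := (mR * mR)%type.

Definition dyidx n x : int := Num.floor (2 ^+ n * x).

(** The squares are half-open, so those of a given generation partition the plane. *)
Definition dysquare n i j : set (R * R) :=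
  [set p | dyidx n p.1 = i /\ dyidx n p.2 = j].

Lemma dyidx_itv n i :
  [set x | dyidx n x = i] = `[(i%:~R / 2 ^+ n), ((i + 1)%:~R / 2 ^+ n)[%classic.
Proof.
have n0 : 0 < 2 ^+ n :> R by rewrite exprn_gt0.
apply/seteqP; split=> x; rewrite /= in_itv /= ler_pdivrMr// ltr_pdivlMr// [x * _]mulrC.
  by move=> <-; exact: floor_itv.
exact: floor_def.
Qed.

(** An integer separating [2 ^ n * x] from [2 ^ n * y] doubles to one separating them at the next
    generation. *)
Lemma dyidx_step n x y : dyidx n.+1 x = dyidx n.+1 y -> dyidx n x = dyidx n y.
Proof.
wlog xy : x y / dyidx n x <= dyidx n y => [H|] E.
  by have [h|h] := leP (dyidx n x) (dyidx n y); [exact: H|rewrite (H y x (ltW h))].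
apply/eqP; rewrite eq_le xy /= leNgt; apply/negP => lt.
have xi := floor_itv (2 ^+ n * x); have yi := floor_itv (2 ^+ n * y).
have xi' := floor_itv (2 ^+ n.+1 * x); have yi' := floor_itv (2 ^+ n.+1 * y).
rewrite -/(dyidx n x) -/(dyidx n y) in xi yi.
rewrite -/(dyidx n.+1 x) -/(dyidx n.+1 y) in xi' yi'.
case/andP: xi => _ xlt; case/andP: yi => yge _.
case/andP: xi' => xge' _; case/andP: yi' => _ ylt'.
have lt1 : (dyidx n x + 1)%:~R <= (dyidx n y)%:~R :> R by rewrite ler_int lezD1.
have h1 : 2 ^+ n.+1 * x < (2 * dyidx n y)%:~R.
  rewrite exprS -mulrA intrM ltr_pM2l//; lra.
have h2 : (2 * dyidx n y)%:~R <= 2 ^+ n.+1 * y.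
  by rewrite exprS -mulrA intrM ler_pM2l.
have : (dyidx n.+1 x)%:~R < (2 * dyidx n y)%:~R :> R by lra.
have : (2 * dyidx n y)%:~R < (dyidx n.+1 y + 1)%:~R :> R by lra.
rewrite !ltr_int E ltzD1 => h3 h4.
by have := le_lt_trans h3 h4; rewrite ltxx.
Qed.

Lemma dyidx_le n m x y : (m <= n)%N -> dyidx n x = dyidx n y -> dyidx m x = dyidx m y.
Proof.
move=> mn; rewrite -(subnKC mn); elim: (n - m)%N => [|k IH]; first by rewrite addn0.
by rewrite addnS => /dyidx_step.
Qed.

Lemma measurable_dysquare n i j : measurable (dysquare n i j : set mR2).
Proof.
have -> : dysquare n i j = [set x | dyidx n x = i] `*` [set x | dyidx n x = j] by [].
by rewrite !dyidx_itv; apply: measurableX; exact: measurable_itv.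
Qed.

Lemma area_dysquare n i j : area R (dysquare n i j) = ((2 ^+ n)^-1 ^+ 2)%:E.
Proof.
have n0 : 0 < 2 ^+ n :> R by rewrite exprn_gt0.
have L k : mu [set x | dyidx n x = k] = ((2 ^+ n)^-1)%:E.
  rewrite dyidx_itv lebesgue_measure_itv /= lte_fin ltr_pM2r ?invr_gt0// ltr_int ltzD1 lexx.
  by rewrite -EFinD -mulrBl -intrB addrAC subrr add0r mul1r.
have -> : dysquare n i j = [set x | dyidx n x = i] `*` [set x | dyidx n x = j] by [].
rewrite areaX; [by rewrite !L expr2 EFinM|by rewrite dyidx_itv; exact: measurable_itv..].
Qed.

Lemma itv_convex (a b x y t : R) : a <= x < b -> a <= y < b -> 0 <= t <= 1 ->
  a <= x + t * (y - x) < b.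
Proof.
move=> /andP[ax xb] /andP[ay yb] /andP[t0 t1].
have [xy|xy] := leP x y.
  have h1 : 0 <= t * (y - x) by rewrite mulr_ge0// subr_ge0.
  have h2 : t * (y - x) <= 1 * (y - x) by rewrite ler_wpM2r// subr_ge0.
  by apply/andP; split; lra.
have h1 : 0 <= t * (x - y) by rewrite mulr_ge0// subr_ge0 ltW.
have h2 : t * (x - y) <= 1 * (x - y) by rewrite ler_wpM2r// subr_ge0 ltW.
by apply/andP; split; lra.
Qed.

Lemma dysquare_convex n i j p q t : dysquare n i j p -> dysquare n i j q -> 0 <= t <= 1 ->
  dysquare n i j (p.1 + t * (q.1 - p.1), p.2 + t * (q.2 - p.2)).
Proof.
have C k x y : dyidx n x = k -> dyidx n y = k -> 0 <= t <= 1 -> dyidx n (x + t * (y - x)) = k.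
  have E := dyidx_itv n k.
  have E' z : dyidx n z = k <-> k%:~R / 2 ^+ n <= z < (k + 1)%:~R / 2 ^+ n.
    by rewrite -[dyidx n z = k]/([set x | dyidx n x = k] z) E /= in_itv.
  by move=> /E' h1 /E' h2 t01; apply/E'; exact: itv_convex.
by move=> [p1 p2] [q1 q2] t01; split; apply: C.
Qed.

Lemma dysquare_dist n i j p q : dysquare n i j p -> dysquare n i j q ->
  normc (toC p - toC q) <= 2 / 2 ^+ n.
Proof.
have C k x y : dyidx n x = k -> dyidx n y = k -> `|x - y| <= 1 / 2 ^+ n.
  have E' z : dyidx n z = k <-> k%:~R / 2 ^+ n <= z < (k + 1)%:~R / 2 ^+ n.
    by rewrite -[dyidx n z = k]/([set x | dyidx n x = k] z) dyidx_itv /= in_itv.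
  move=> /E'/andP[x1 x2] /E'/andP[y1 y2].
  have e : (k + 1)%:~R / 2 ^+ n = k%:~R / 2 ^+ n + 1 / 2 ^+ n :> R by rewrite intrD mulrDl.
  by rewrite ler_norml; apply/andP; split; lra.
move=> [p1 p2] [q1 q2]; apply: (le_trans (normc_leD _)); rewrite ReD ReN ImD ImN /=.
by have := C _ _ _ p1 q1; have := C _ _ _ p2 q2; lra.
Qed.

Lemma dysquare_corner n i j : dysquare n i j (i%:~R / 2 ^+ n, j%:~R / 2 ^+ n).
Proof.
have C k : dyidx n (k%:~R / 2 ^+ n) = k.
  rewrite /dyidx mulrC divfK ?expf_neq0//.
  by apply: floor_def; rewrite lexx ltr_int ltzD1 lexx.
by split; exact: C.
Qed.

Variable good : nat -> int -> int -> Prop.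

(** Dyadic squares are nested or disjoint, so missing every coarser good square amounts to being
    maximal among good squares. *)
Definition dymax n i j := good n i j /\ forall m i' j', (m < n)%N -> good m i' j' ->
  dysquare n i j `&` dysquare m i' j' = set0.

Lemma dymax_disjoint n i j m i' j' : dymax n i j -> dymax m i' j' ->
  dysquare n i j `&` dysquare m i' j' !=set0 -> (n, i, j) = (m, i', j').
Proof.
move=> [g1 h1] [g2 h2] [p [p1 p2]].
have [nm|mn|nm] := ltngtP n m.
- have := h2 n i j nm g1; rewrite setIC => /seteqP[/(_ p)].
  by move=> /(_ (conj p1 p2)).
- have := h1 m i' j' mn g2 => /seteqP[/(_ p)].
  by move=> /(_ (conj p1 p2)).
- by subst m; case: p1 => <- <-; case: p2 => <- <-.
Qed.

(** Take the least generation at which the square around [p] is good: a coarser good square meeting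
    it would contain [p] and contradict minimality. *)
Lemma dymax_cover p n : good n (dyidx n p.1) (dyidx n p.2) ->
  exists m i j, dymax m i j /\ dysquare m i j p.
Proof.
move=> gn; pose P k := `[< good k (dyidx k p.1) (dyidx k p.2) >].
have exP : exists k, P k by exists n; exact/asboolP.
have [m /asboolP Pm mmin] := ex_minnP exP.
exists m, (dyidx m p.1), (dyidx m p.2); split; last by [].
split=> // k i' j' km gk; apply/seteqP; split=> // q [[q1 q2] [q3 q4]].
have := mmin k; rewrite leqNgt km => H; apply: notF; apply: H; apply/asboolP.
by rewrite -(dyidx_le (ltnW km) q1) -(dyidx_le (ltnW km) q2) q3 q4.
Qed.

End dyadic.

(** * Finite area of the image *)

Section image_area.
Variable R : realType.
Implicit Types (x y : R) (p q : R * R) (n m : nat) (i j : int).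
Local Notation mu := (@lebesgue_measure R).
Local Notation mR := (measurableTypeR R).
Local Notation mR2 := (mR * mR)%type.

Variable F : R[i] -> R[i].
Hypotheses (hF : holo F) (iF' : L2 F^`()%classic).
Let F' := F^`()%classic.
Let density p : \bar R := (2 * normc (F' (toC p)) ^+ 2 + 8)%:E.

(* The maximal tame squares partition the disc; on each of them the area of a box
   containing the image is controlled by the integral of [density]. *)
Definition tame n i j := dysquare n i j `<=` planar_disc R /\
  forall p q, dysquare n i j p -> dysquare n i j q ->
    normc (F' (toC p)) <= normc (F' (toC q)) + 1.

Lemma tame_cover p : planar_disc R p -> exists n, tame n (dyidx n p.1) (dyidx n p.2).
Proof.
have tri (a b c : R[i]) : normc (a - c) < 1 / 2 -> normc (b - c) < 1 / 2 ->
    normc a <= normc b + 1.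
  have := le_normcD (a - c) (c - b); have := le_normcD (a - b) b.
  by rewrite subrKA subrK (normcB c); lra.
move=> Dp; have /near_normcP[d1 d10 dD] := disc_near Dp.
have /cts_normcP/(_ (1 / 2))[|d2 d20 dF'] := holo_cts (holo_derive hF) Dp.
  by rewrite divr_gt0.
have d0 : 0 < Num.min d1 d2 by rewrite lt_min d10.
have [n nP] : exists n, 2 / 2 ^+ n < Num.min d1 d2.
  have Ld : 0 <= 2 / Num.min d1 d2 by rewrite divr_ge0// ltW.
  exists (Num.truncn (2 / Num.min d1 d2)).+1; rewrite ltr_pdivrMr ?exprn_gt0// mulrC -ltr_pdivrMr//.
  have /andP[_ h] := truncn_itv Ld.
  apply: (lt_le_trans h); rewrite -natrX ler_nat; exact/ltnW/ltn_expl.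
have close q : dysquare n (dyidx n p.1) (dyidx n p.2) q ->
    normc (toC q - toC p) < d1 /\ normc (toC q - toC p) < d2.
  move=> Qq; have := @dysquare_dist _ n _ _ q p Qq (conj erefl erefl).
  by move=> /le_lt_trans/(_ nP); rewrite lt_min => /andP[].
exists n; split=> [q /close[q1 _]|q q' /close[_ q2] /close[_ q2']]; first exact: dD.
exact: tri (dF' _ q2) (dF' _ q2').
Qed.

Let corner n i j : R * R := (i%:~R / 2 ^+ n, j%:~R / 2 ^+ n).
Let slope n i j : R := normc (F' (toC (corner n i j))) + 1.
Let radius n i j : R := slope n i j * (2 / 2 ^+ n).
(** On a tame square [slope] bounds the modulus of the derivative and [2 / 2 ^ n] the distance to
    the corner, so the mean value estimate keeps the image within [radius] of the image of the
    corner. *)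
Let imbox n i j : set (R * R) :=
  let c := F (toC (corner n i j)) in let h := radius n i j in
  `[Re c - h, Re c + h]%classic `*` `[Im c - h, Im c + h]%classic.

Let slope_ge0 n i j : 0 <= slope n i j.
Proof. by rewrite addr_ge0// normc_ge0. Qed.

Let radius_ge0 n i j : 0 <= radius n i j.
Proof. by rewrite mulr_ge0// divr_ge0// exprn_ge0. Qed.

Lemma tame_image n i j p : tame n i j -> dysquare n i j p ->
  imbox n i j (Re (F (toC p)), Im (F (toC p))).
Proof.
have tri (a b h : R) : - h <= a - b -> a - b <= h -> b - h <= a <= b + h.
  by move=> *; apply/andP; split; lra.
move=> [QD QF'] Qp; have Qc := @dysquare_corner R n i j.
have dist : normc (toC p - toC (corner n i j)) <= 2 / 2 ^+ n by exact: dysquare_dist Qp Qc.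
have mv L : real_part_like L ->
    `|L (F (toC p)) - L (F (toC (corner n i j)))| <= radius n i j.
  move=> LL; apply: (@le_trans _ _ (slope n i j * normc (toC p - toC (corner n i j)))).
    apply: (mean_value_part (F := F) LL) => t t01.
    have Qt := dysquare_convex Qc Qp t01.
    have -> : toC (corner n i j) + t%:C * (toC p - toC (corner n i j)) =
      toC ((corner n i j).1 + t * (p.1 - (corner n i j).1),
           (corner n i j).2 + t * (p.2 - (corner n i j).2)).
      by apply/complexP => /=; rewrite mul0r ?subr0 ?addr0.
    split; last exact: QF'.
    by apply: hF; exact: (QD _ Qt).
  by rewrite ler_wpM2l.
have := mv _ (@Re_part_like R); have := mv _ (@Im_part_like R).
rewrite !ler_norml => /andP[h1 h2] /andP[h3 h4].
by split; rewrite /= in_itv /=; exact: tri.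
Qed.

Lemma measurable_imbox n i j : measurable (imbox n i j : set mR2).
Proof. by apply: measurableX; exact: measurable_itv. Qed.

Lemma area_imbox n i j :
  area R (imbox n i j) = (16 * slope n i j ^+ 2 * (2 ^+ n)^-1 ^+ 2)%:E.
Proof.
have W (c h : R) : 0 <= h -> c - h <= c + h by lra.
rewrite areaX; [|exact: measurable_itv..].
rewrite !mu_itvcc ?W// -EFinM; congr EFin; rewrite /radius; ring.
Qed.

Lemma measurable_density : measurable_fun (planar_disc R : set mR2) density.
Proof.
rewrite /density; under eq_fun do rewrite EFinD EFinM.
apply: emeasurable_funD; last exact: measurable_cst.
by apply: measurable_funeM; apply: measurable_normc2; exact: holo_cts (holo_derive hF).
Qed.

Lemma density_ge0 p : (0 <= density p)%E.
Proof. by rewrite lee_fin addr_ge0// mulr_ge0// sqr_ge0. Qed.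

Lemma density_fin : (\int[area R]_(p in planar_disc R) density p < +oo)%E.
Proof.
have mD := @measurable_planar R.
have m2 := measurable_normc2 (holo_cts (holo_derive hF)).
have n0 p : planar_disc R p -> (0 <= (normc (F' (toC p)) ^+ 2)%:E)%E.
  by move=> _; rewrite lee_fin sqr_ge0.
have n1 p : planar_disc R p -> (0 <= 2%:E * (normc (F' (toC p)) ^+ 2)%:E)%E.
  by move=> Dp; apply: mule_ge0 => //; exact: n0.
rewrite /density; under eq_integral do rewrite EFinD EFinM.
rewrite ge0_integralD//; last exact: measurable_funeM.
rewrite integral_cst// ge0_integralZl_EFin//.
by apply: lte_add_pinfty; apply: lte_mul_pinfty => //; exact: area_disc_fin.
Qed.

(** The box has area [16 * slope ^ 2] times that of the square. On a tame square [slope] is at most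
    [r + 2], with [r] the modulus of the derivative at any point, and
    [(r + 2) ^ 2 <= 2 * r ^ 2 + 8]: this is where [density] comes from. *)
Lemma area_imbox_le n i j : tame n i j ->
  (area R (imbox n i j) <= 16%:E * \int[area R]_(p in dysquare n i j) density p)%E.
Proof.
have le_sq (s r : R) : 0 <= s -> 0 <= r -> s <= r + 1 ->
    (s + 1) ^+ 2 <= 2 * r ^+ 2 + 8.
  move=> s0 r0 sr; apply: (@le_trans _ _ ((r + 2) ^+ 2)).
    by rewrite ler_pXn2r ?nnegrE ?addr_ge0//; lra.
  by rewrite -subr_ge0 (_ : _ - _ = (r - 2) ^+ 2) ?sqr_ge0//; ring.
move=> [QD QF']; have mQ := @measurable_dysquare R n i j.
have Qc := @dysquare_corner R n i j.
rewrite area_imbox -mulrA EFinM; apply: lee_wpmul2l; first by rewrite lee_fin.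
have -> : ((slope n i j ^+ 2 * (2 ^+ n)^-1 ^+ 2)%:E =
    \int[area R]_(p in dysquare n i j) (slope n i j ^+ 2)%:E)%E.
  by rewrite integral_cst// area_dysquare EFinM.
apply: ge0_le_integral.
- exact: mQ.
- by move=> p _; rewrite lee_fin sqr_ge0.
- exact: measurable_cst.
- exact: measurable_funS (@measurable_planar R) QD measurable_density.
- move=> p Qp; rewrite lee_fin.
  by apply: le_sq; [exact: normc_ge0|exact: normc_ge0|exact: QF' _ _ Qc Qp].
Qed.

(** An enumeration by natural numbers, empty at the indices that code no maximal tame square, so
    that countable unions and series apply. *)
Let family (A : nat -> int -> int -> set (R * R)) (k : nat) : set (R * R) :=
  if pickle_inv k is Some (n, i, j) then
    (if `[< dymax R tame n i j >] then A n i j else set0) else set0.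

Let familyP k : (exists n i j, [/\ pickle_inv k = Some (n, i, j), dymax R tame n i j &
  forall B, family B k = B n i j]) \/ (forall B, family B k = set0) .
Proof.
rewrite /family; case E : (pickle_inv k) => [[[n i] j]|]; last by right.
have [h|h] := pselect (dymax R tame n i j); last by right=> B; rewrite asboolF.
by left; exists n, i, j; split=> // B; rewrite asboolT.
Qed.

Let family_measurable (A : nat -> int -> int -> set (R * R)) k :
  (forall n i j, measurable (A n i j : set mR2)) ->
  measurable (family A k : set mR2).
Proof.
move=> mA; have [[n [i [j [_ _ ->]]]]|->] := familyP k; first exact: mA.
exact: measurable0.
Qed.

(** [B] is the union of the boxes, a measurable set enclosing the image. Subadditivity bounds its
    area by the sum of theirs, and disjointness of the squares adds up the integrals of [density] to
    at most the one over the disc. *)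
Lemma image_area_fin : exists2 B : set (R * R), measurable (B : set mR2) &
  (area R B < +oo)%E /\
  forall p, planar_disc R p -> B (Re (F (toC p)), Im (F (toC p))).
Proof.
pose Q := family (@dysquare R); pose I := family imbox.
have mQ k : measurable (Q k : set mR2).
  by apply: family_measurable => *; exact: measurable_dysquare.
have mI k : measurable (I k : set mR2).
  by apply: family_measurable => *; exact: measurable_imbox.
have mUI : measurable (\bigcup_k I k : set mR2) by exact: bigcupT_measurable.
have mUQ : measurable (\bigcup_k Q k : set mR2) by exact: bigcupT_measurable.
have QD : \bigcup_k Q k `<=` planar_disc R.
  move=> p [k _]; rewrite /Q; have [[n [i [j [_ [[h _] _] ->]]]]|->//] := familyP k.
  exact: h.
exists (\bigcup_k I k) => //; split; last first.
  move=> p Dp; have [n gn] := tame_cover Dp.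
  have [m [i [j [mx Qp]]]] := dymax_cover gn.
  exists (pickle (m, i, j)) => //; rewrite /I /family pickleK_inv asboolT//.
  by apply: tame_image => //; case: mx.
have trivQ : trivIset setT Q.
  move=> k l _ _; rewrite /Q.
  have [[n [i [j [Ek mk ->]]]]|->] := familyP k; last by rewrite set0I => -[].
  have [[n' [i' [j' [El ml ->]]]]|->] := familyP l; last by rewrite setI0 => -[].
  move=> /(dymax_disjoint mk ml) E.
  have := pickle_invK (T := (nat * int * int)%type) k.
  have := pickle_invK (T := (nat * int * int)%type) l.
  by rewrite Ek El /= => <- <-; rewrite E.
have boole := generalized_Boole_inequality (area R) mI mUI.
apply: le_lt_trans boole _.
have ge0Q k : (0 <= \int[area R]_(p in Q k) density p)%E.
  by apply: integral_ge0 => p _; exact: density_ge0.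
apply: (@le_lt_trans _ _ (\sum_(0 <= k <oo) (16%:E * \int[area R]_(p in Q k) density p))%E).
  apply: lee_nneseries => [k _ _|k _]; first exact: measure_ge0.
  rewrite /I /Q; have [[n [i [j [_ [tk _] E]]]]|E] := familyP k; rewrite !E.
    exact: area_imbox_le.
  by rewrite measure0 integral_set0 mule0.
rewrite nneseriesZl//; apply: lte_mul_pinfty; rewrite ?lee_fin//.
have mdQ := measurable_funS (@measurable_planar R) QD measurable_density.
rewrite -(@ge0_integral_bigcup _ _ _ (area R) _ _ mQ mdQ (fun p _ => density_ge0 p) trivQ).
apply: le_lt_trans density_fin; apply: ge0_subset_integral.
- exact: mUQ.
- exact: measurable_planar.
- exact: measurable_density.
- by move=> p _; exact: density_ge0.
- exact: QD.
Qed.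

(* The plane has infinite area. *)
Theorem omits_two_values : exists l1 l2, l1 != l2 /\
  forall z, disc R z -> F z != l1 /\ F z != l2.
Proof.
apply: contrapT => H.
(* If two values are not omitted, at most one is; when none is, [0] is a placeholder. *)
have [l0 l0P] : exists l0, forall l, l != l0 -> exists2 z, disc R z & F z = l.
  have [[l lP]|no] := pselect (exists l, forall z, disc R z -> F z != l).
    exists l => l' ll'; apply: contrapT => nz; apply: H; exists l', l; split=> // z Dz.
    by split; [apply/eqP => Fz; apply: nz; exists z|exact: lP].
  exists 0 => l _; apply: contrapT => nz; apply: no; exists l => z Dz.
  by apply/eqP => Fz; apply: nz; exists z.
have [B mB [Bfin BP]] := image_area_fin.
have mpt : measurable ([set Re l0] `*` [set Im l0] : set mR2) by apply: measurableX.
have cover : [set: mR2] `<=` B `|` ([set Re l0] `*` [set Im l0]).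
  move=> [x y] _; have [<-|/l0P[[a b] Dz E]] := eqVneq (x +i* y) l0; first by right.
  by left; have := BP (a, b) Dz; rewrite /toC /= E.
have : (area R [set: mR2] < +oo)%E.
  apply: (@le_lt_trans _ _ (area R (B `|` ([set Re l0] `*` [set Im l0])))).
    by apply: le_measure => //; rewrite inE//; exact: measurableU.
  apply: (le_lt_trans (measureU2 (area R) mB mpt)).
  have pt0 : area R ([set Re l0] `*` [set Im l0]) = 0%E.
    by rewrite areaX// lebesgue_measure_set1 mul0e.
  by rewrite [X in (_ + X < _)%E]pt0 adde0.
have -> : [set: mR2] = [set: mR] `*` [set: mR] by rewrite setXTT.
rewrite areaX//; have -> : mu [set: mR] = +oo%E.
  by rewrite -set_itvNyy lebesgue_measure_itv.
by rewrite mulyy ltxx.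
Qed.

End image_area.

(** * The Gleason-Kahane-Zelazko argument for polynomials *)

Section gleason_kahane_zelazko.
Variable R : realType.
Local Notation C := R[i].
Implicit Types (p q : {poly C}) (x z w : C) (s : seq C).

Lemma poly_disc_bounded p : exists2 B : R, 0 < B &
  forall z, disc R z -> normc p.[z] <= B.
Proof.
elim/poly_ind: p => [|p c [B B0 BP]].
  by exists 1 => // z _; rewrite horner0 Normc.normc0.
exists (B + normc c); first by rewrite ltr_pwDl// normc_ge0.
move=> z Dz; rewrite hornerMXaddC; apply: (le_trans (le_normcD _ _)).
rewrite lerD2r Normc.normcM; apply: (@le_trans _ _ (normc p.[z])); last exact: BP.
by rewrite ler_piMr ?normc_ge0//; apply: ltW; exact/discE.
Qed.

(** The normalization at 0 excludes the root 0, so each linear factor can be written with the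
    inverse of its root; an upper bound on these inverses is what a zero-free disc provides. *)
Lemma poly_factor_inv p : p.[0] = 1 -> exists s,
  [/\ p = \prod_(x <- s) (1 - x%:P * 'X), size p = (size s).+1 &
      forall x, x \in s -> x != 0 /\ root p x^-1].
Proof.
move=> p0; have [r rE] := closed_field_poly_normal p.
have pn0 : p != 0 by apply/eqP => pz; move: p0; rewrite pz horner0 => /esym/eqP; rewrite oner_eq0.
have lc0 : lead_coef p != 0 by rewrite lead_coef_eq0.
have rn0 x : x \in r -> x != 0.
  move=> xr; apply/eqP => x0; move: p0; rewrite rE hornerZ -/(root _ _).
  have /rootP -> : root (\prod_(z <- r) ('X - z%:P)) 0 by rewrite root_prod_XsubC -x0.
  by rewrite mulr0 => /esym/eqP; rewrite oner_eq0.
have [c E] : exists c, \prod_(z <- r) ('X - z%:P) =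
    c *: \prod_(x <- [seq x^-1 | x <- r]) (1 - x%:P * 'X).
  elim: r rn0 {rE} => [|z r IH] rn0; first by exists 1; rewrite !big_nil scale1r.
  have [|c Ec] := IH; first by move=> x xr; apply: rn0; rewrite inE xr orbT.
  have z0 : z != 0 by apply: rn0; rewrite inE eqxx.
  have Ez : 'X - z%:P = (- z) *: (1 - (z^-1)%:P * 'X).
    by rewrite scaleNr scalerBr -!mul_polyC mulr1 mulrA -polyCM mulfV// mul1r opprB.
  by exists (- z * c); rewrite /= !big_cons Ec Ez -scalerAl -scalerAr scalerA.
have Q0 s : (\prod_(x <- s) (1 - x%:P * 'X)).[0] = 1.
  rewrite horner_prod big1// => x _.
  by rewrite hornerD hornerN hornerM hornerX mulr0 subr0 hornerC.
have c1 : lead_coef p * c = 1.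
  by move: p0; rewrite {1}rE E scalerA hornerZ Q0 mulr1.
exists [seq x^-1 | x <- r]; split.
- by rewrite {1}rE E scalerA c1 scale1r.
- by rewrite rE size_scale// size_prod_XsubC size_map.
- move=> _ /mapP[x xr ->]; rewrite invr_eq0 invrK rn0//; split=> //.
  by rewrite rE rootZ// root_prod_XsubC.
Qed.

(** Newton's identity for the second power sum: [p]_1[is minus the first elementary symmetric
    function of]s[, and]p[_2] is the second. *)
Lemma coef_prod_inv s : let p := \prod_(x <- s) (1 - x%:P * 'X) in
  p`_0 = 1 /\ p`_1 ^+ 2 - 2 * p`_2 = \sum_(x <- s) x ^+ 2.
Proof.
elim: s => [|x s [IH0 IH]] /=.
  by rewrite !big_nil !coef1 /=; split=> //; rewrite expr0n mulr0 subr0.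
rewrite !big_cons; set q := \prod_(_ <- s) _ in IH0 IH *.
have -> : (1 - x%:P * 'X) * q = q - x *: (q * 'X).
  by rewrite mulrBl mul1r -mulrA ['X * q]mulrC mul_polyC.
rewrite !coefB !coefZ !coefMX /= IH0 -IH; split; first by rewrite mulr0 subr0.
ring.
Qed.

Variable l : {poly C} -> C.
Hypothesis l_lin : forall c p q, l (c *: p + q) = c * l p + l q.
Hypothesis l1 : l 1 = 1.
Hypothesis l_neq0 : forall p, (forall z, disc R z -> p.[z] != 0) -> l p != 0.

Let l0 : l 0 = 0.
Proof. by have := l_lin (-1) 0 0; rewrite scaler0 addr0 mulN1r addNr. Qed.

Let lD p q : l (p + q) = l p + l q.
Proof. by have := l_lin 1 p q; rewrite scale1r mul1r. Qed.

Let lZ c p : l (c *: p) = c * l p.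
Proof. by have := l_lin c p 0; rewrite l0 !addr0. Qed.

Let lMn p n : l (p *+ n) = l p *+ n.
Proof. by elim: n => [|n IH]; rewrite ?mulr0n ?l0// !mulrS lD IH. Qed.

Let l_sum n (F : 'I_n -> {poly C}) : l (\sum_(i < n) F i) = \sum_(i < n) l (F i).
Proof. by elim/big_ind2: _ => // a b c d <- <-; rewrite lD. Qed.

(* [l ((1 + w p) ^ N)] is a polynomial in [w] without zeros in [|w| < 1 / B];
   the left-hand side is the sum of the squares of its inverse roots. *)
Lemma functional_moment_bound p (B : R) N : 0 < B ->
  (forall z, disc R z -> normc p.[z] <= B) ->
  normc ((N%:R * l p) ^+ 2 - N%:R * (N.-1)%:R * l (p ^+ 2)) <= N%:R * B ^+ 2.
Proof.
move=> B0 pB.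
pose P : {poly C} := \poly_(k < N.+1) (l (p ^+ k) *+ 'C(N, k)).
have PE w : P.[w] = l ((1 + w *: p) ^+ N).
  rewrite horner_poly exprDn l_sum; apply: eq_bigr => k _.
  by rewrite expr1n mul1r exprZn lMn lZ mulrnAl mulrC.
have P0 : P.[0] = 1 by rewrite PE scale0r addr0 expr1n.
have [s [Ps sizeP sP]] := poly_factor_inv P0.
have [_ coefs] := coef_prod_inv s; rewrite -Ps in coefs.
have c1 : P`_1 = N%:R * l p.
  rewrite coef_poly; case: ltnP => [_|]; first by rewrite bin1 expr1 mulr_natl.
  by rewrite ltnS leqn0 => /eqP ->; rewrite mul0r.
(* [2 * 'C(N, 2) = N * (N - 1)]. For [N < 2] the coefficient is out of range and the right-hand side
   is 0 as well. *)
have c2 : 2 * P`_2 = N%:R * (N.-1)%:R * l (p ^+ 2).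
  rewrite coef_poly; case: ltnP => [_|].
    by rewrite -[l _ *+ _]mulr_natl mulrA -!natrM -mul_bin_diag bin1.
  by rewrite !ltnS; case: N {P PE P0 Ps sizeP sP coefs c1} => [|[|]]//= _;
      rewrite ?mul0r ?mulr0 ?mul0r.
rewrite -c1 -c2 coefs.
have sizes : (size s <= N)%N by rewrite -ltnS -sizeP; exact: size_poly.
have sB x : x \in s -> normc x <= B.
  move=> /sP[x0 /rootP Px]; rewrite leNgt; apply/negP => Bx.
  suff : P.[x^-1] != 0 by rewrite Px eqxx.
  rewrite PE; apply: l_neq0 => z Dz; rewrite horner_exp expf_neq0//.
  rewrite hornerD hornerZ hornerC; apply/eqP => /eqP; rewrite addrC addr_eq0 => /eqP E.
  have : normc (x^-1 * p.[z]) < 1.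
    rewrite Normc.normcM Normc.normcV mulrC ltr_pdivrMr ?mul1r ?normc_gt0//.
    exact: le_lt_trans (pB z Dz) Bx.
  by rewrite E normcN Normc.normc1 ltxx.
have : normc (\sum_(x <- s) x ^+ 2) <= (size s)%:R * B ^+ 2.
  elim: s sB {Ps sizeP sP coefs sizes} => [|x s IH] sB.
    by rewrite big_nil Normc.normc0 mul0r.
  rewrite big_cons; apply: (le_trans (le_normcD _ _)).
  rewrite /= -natr1 mulrDl mul1r addrC; apply: lerD.
    by apply: IH => y ys; apply: sB; rewrite inE ys orbT.
  by rewrite normcX ler_pXn2r ?nnegrE ?normc_ge0 ?(ltW B0)// sB// inE eqxx.
move=> /le_trans; apply; rewrite ler_pM2r ?exprn_gt0// ler_nat//.
Qed.

(** In [functional_moment_bound] the defect [l p ^ 2 - l (p ^ 2)] is multiplied by [N ^ 2], while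
    all other terms grow linearly in [N]. *)
Lemma functional_sqr p : l (p ^+ 2) = l p ^+ 2.
Proof.
have [B B0 pB] := poly_disc_bounded p.
apply/eqP; rewrite eq_sym -subr_eq0 -normc_eq0; apply/negPn/negP => d0.
have {d0} d0 : 0 < normc (l p ^+ 2 - l (p ^+ 2)) by rewrite lt_def d0 normc_ge0.
set d := normc _ in d0.
pose m := normc (l (p ^+ 2)).
have m0 : 0 <= m by exact: normc_ge0.
have bound N : (0 < N)%N -> N%:R * d <= B ^+ 2 + m.
  move=> N0; have N0' : 0 < N%:R :> R by rewrite ltr0n.
  rewrite -(ler_pM2l N0'); have := functional_moment_bound N B0 pB.
  have -> : (N%:R * l p) ^+ 2 - N%:R * (N.-1)%:R * l (p ^+ 2) =
      N%:R * (N%:R * (l p ^+ 2 - l (p ^+ 2)) + l (p ^+ 2)).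
    by rewrite -subn1 natrB//; ring.
  have nN : normc (N%:R : C) = N%:R by rewrite -(rmorph_nat (real_complex R)) normc_real ger0_norm.
  rewrite Normc.normcM nN !(ler_pM2l N0') => h.
  have := le_normcD (N%:R * (l p ^+ 2 - l (p ^+ 2)) + l (p ^+ 2)) (- l (p ^+ 2)).
  by rewrite addrK normcN Normc.normcM nN -/d -/m => /le_trans; apply; rewrite lerD2r.
have Bm0 : 0 <= (B ^+ 2 + m) / d by rewrite divr_ge0 ?addr_ge0 ?sqr_ge0// ltW.
have /andP[_ h] := truncn_itv Bm0.
have := bound (Num.truncn ((B ^+ 2 + m) / d)).+1 isT.
by rewrite leNgt -ltr_pdivrMr// h.
Qed.

(** Polarization of [functional_sqr]. *)
Lemma functional_mul p q : l (p * q) = l p * l q.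
Proof.
have := functional_sqr (p + q).
rewrite (lD p q) !sqrrD (lD (p ^+ 2 + _) (q ^+ 2)) (lD (p ^+ 2)) lMn.
rewrite (functional_sqr p) (functional_sqr q) => /addIr/addrI E.
have two0 : (2%:R : C) != 0 by rewrite pnatr_eq0.
by apply: (mulfI two0); rewrite !mulr_natl E.
Qed.

(** The point is [l 'X]: outside the disc, it would make ['X - l 'X] free of zeros there although
    [l] kills it. *)
Theorem gleason_kahane_zelazko : exists2 a, disc R a & forall p, l p = p.[a].
Proof.
exists (l 'X).
  apply: contrapT => nD; have : l ('X - (l 'X)%:P) != 0.
    apply: l_neq0 => z Dz; rewrite hornerD hornerN hornerX hornerC subr_eq0.
    by apply/eqP => zE; apply: nD; rewrite -zE.
  by rewrite -alg_polyC -scaleNr lD lZ l1 mulr1 subrr eqxx.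
elim/poly_ind => [|p c IH]; first by rewrite l0 horner0.
by rewrite hornerMXaddC lD functional_mul IH -alg_polyC lZ l1 mulr1.
Qed.

End gleason_kahane_zelazko.

(** * Functionals on the Dirichlet space *)

Section dirichlet_space.
Variable R : realType.
Implicit Types (f g k : dirichlet R) (u a : disc R) (p : {poly R[i]}).

Lemma valL_val (f : disc R -> R[i]) u : 'valL_0 f (val u) = f u.
Proof. by rewrite /valL_ /= oinv_set_val valK. Qed.

Lemma disc_val u : disc R (val u).
Proof. exact: set_valP. Qed.

Lemma dirichlet_holo f : holo ('valL_0 f) /\ L2 ('valL_0 f)^`()%classic.
Proof. by have /asboolP[hf /dirichlet_fin] := dirichlet_funP f. Qed.

Lemma dirichlet_ext f g : (forall u, f u = g u) -> f = g.
Proof. by move=> fg; apply: val_inj; apply/funext. Qed.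

Lemma dirichletD f g u : (f + g) u = f u + g u. Proof. by []. Qed.
Lemma dirichletZ (c : R[i]) f u : (c *: f) u = c * f u. Proof. by []. Qed.
Lemma dirichlet1 u : dirichlet_one R u = 1. Proof. by []. Qed.

Lemma in_dirichlet_restrict (F : R[i] -> R[i]) : holo F -> L2 F^`()%classic ->
  (fun u => F (val u)) \in in_dirichlet R.
Proof.
move=> hF iF; set f := fun u => F (val u).
have near_F z : disc R z -> {near z, 'valL_0 f =1 F}.
  move=> Dz; have := disc_near Dz; apply: filterS => w Dw.
  have wD : w \in disc R by rewrite inE.
  by have := valL_val f (Sub w wD).
apply/asboolP; split=> [z Dz|].
  apply: (@near_eq_derivable _ _ _ F); last exact: hF.
  by apply: filterS (near_F z Dz) => w ->.
apply/dirichlet_fin; apply: le_lt_trans iF; rewrite le_eqVlt; apply/orP; left; apply/eqP.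
apply: eq_integral => p; rewrite inE => Dp.
by rewrite !derive1E (near_eq_derive _ (near_F _ Dp)).
Qed.

Lemma dirichlet_mulX f : exists g, forall u, g u = val u * f u.
Proof.
have [hf iff'] := dirichlet_holo f.
exists (Dirichlet (in_dirichlet_restrict (holo_mulX hf) (L2_mulX hf iff'))) => u.
by rewrite -[in RHS](valL_val f u).
Qed.

Lemma dirichlet_quotient f a : exists g, forall u, f u = f a + (val u - val a) * g u.
Proof.
have [hf iff'] := dirichlet_holo f; have Da := disc_val a.
exists (Dirichlet (in_dirichlet_restrict (holo_dquot hf Da) (L2_dquot hf Da iff'))) => u.
by rewrite -(valL_val f u) -(valL_val f a); exact: dquotP.
Qed.

Lemma dirichlet_mul_poly p f : exists g, forall u, g u = p.[val u] * f u.
Proof.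
elim/poly_ind: p => [|p c [g gE]].
  by exists 0 => u; rewrite horner0 mul0r.
have [h hE] := dirichlet_mulX g; exists (h + c *: f) => u.
by rewrite dirichletD dirichletZ hE gE hornerMXaddC; ring.
Qed.

(** Chosen from an existence statement proved by induction on [p]; its values determine it by
    [dirichlet_ext]. *)
Definition mul_poly p f : dirichlet R := sval (cid (dirichlet_mul_poly p f)).

Lemma mul_polyE p f u : mul_poly p f u = p.[val u] * f u.
Proof. exact: (svalP (cid (dirichlet_mul_poly p f))). Qed.

Lemma dirichlet_omits f : exists l1 l2, l1 != l2 /\ forall u, f u != l1 /\ f u != l2.
Proof.
have [hf iff'] := dirichlet_holo f.
have [l1 [l2 [l12 H]]] := omits_two_values hf iff'.
by exists l1, l2; split=> // u; rewrite -(valL_val f u); exact: H (disc_val u).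
Qed.

Section functional.
Variable Lambda : {linear dirichlet R -> R[i]}.
Hypothesis Lambda1 : Lambda (dirichlet_one R) = 1.
Hypothesis Lambda_neq0 : forall g, (forall u, g u != 0) -> Lambda g != 0.

Let LambdaD f g : Lambda (f + g) = Lambda f + Lambda g.
Proof. exact: linearD. Qed.

Let LambdaZ (c : R[i]) f : Lambda (c *: f) = c * Lambda f.
Proof. exact: linearZ. Qed.

Lemma functional_nonvanishing k : (forall u, k u != 0) ->
  exists a, forall p, Lambda (mul_poly p k) = p.[val a] * Lambda k.
Proof.
move=> k0; have Lk := Lambda_neq0 k0.
have [||| a Da aP] := @gleason_kahane_zelazko R (fun p => Lambda (mul_poly p k) / Lambda k).
- move=> c p q; have -> : mul_poly (c *: p + q) k = c *: mul_poly p k + mul_poly q k.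
    apply: dirichlet_ext => u; rewrite dirichletD dirichletZ !mul_polyE.
    by rewrite hornerD hornerZ; ring.
  by rewrite LambdaD LambdaZ mulrDl mulrA.
- have -> : mul_poly 1 k = k.
    by apply: dirichlet_ext => u; rewrite mul_polyE hornerC mul1r.
  by rewrite mulfV.
- move=> p p0; rewrite mulf_neq0 ?invr_eq0//; apply: Lambda_neq0 => u.
  by rewrite mul_polyE mulf_neq0//; apply: p0; exact: disc_val.
- have aD : a \in disc R by rewrite inE.
  by exists (Sub a aD) => p; rewrite -aP divfK.
Qed.

Lemma functional_poly : exists a, forall p f,
  Lambda (mul_poly p f) = p.[val a] * Lambda f.
Proof.
have [a0 a0P] : exists a, forall p, Lambda (mul_poly p (dirichlet_one R)) = p.[val a].
  have [|a aP] := @functional_nonvanishing (dirichlet_one R).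
    by move=> u; rewrite dirichlet1 oner_neq0.
  by exists a => p; rewrite aP Lambda1 mulr1.
exists a0 => p f; have [l1 [l2 [l12 H]]] := dirichlet_omits f.
pose k l := f - l *: dirichlet_one R.
have kE l u : k l u = f u - l by rewrite /k -scaleNr dirichletD dirichletZ dirichlet1; ring.
have Lk l : Lambda (k l) = Lambda f - l.
  by rewrite /k -scaleNr LambdaD LambdaZ Lambda1 mulr1.
have Lpk q l : Lambda (mul_poly q (k l)) = Lambda (mul_poly q f) - l * q.[val a0].
  have -> : mul_poly q (k l) = mul_poly q f + (- l) *: mul_poly q (dirichlet_one R).
    apply: dirichlet_ext => u; rewrite dirichletD dirichletZ !mul_polyE kE dirichlet1.
    by ring.
  by rewrite LambdaD LambdaZ a0P mulNr.
have [u|a1 a1P] := @functional_nonvanishing (k l1).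
  by rewrite kE subr_eq0; have [] := H u.
have [u|a2 a2P] := @functional_nonvanishing (k l2).
  by rewrite kE subr_eq0; have [] := H u.
have s0 : Lambda (k l1) != 0.
  by apply: Lambda_neq0 => u; rewrite kE subr_eq0; have [] := H u.
have E q : q.[val a1] * (Lambda f - l1) + l1 * q.[val a0] =
    q.[val a2] * (Lambda f - l2) + l2 * q.[val a0].
  have := a1P q; have := a2P q; rewrite !Lpk !Lk => <- <-.
  by rewrite !subrK.
have {E} E q : q.[val a1] * (Lambda f - l1) = q.[val a2] * (Lambda f - l2) + (l2 - l1) * q.[val a0].
  by apply: (addIr (l1 * q.[val a0])); rewrite E; ring.
(* [E] equates a combination of the evaluations at [a1] and [a0] with nonzero
   coefficients to a multiple of the evaluation at [a2]. *)
have a10 : val a1 = val a0.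
  apply/eqP/negPn/negP => a10.
  have a12 : val a1 = val a2.
    (* Vanishing at [a2] and [a0] isolates the term at [a1]. Once [a1 = a2], the factor ['X - a2]
       alone isolates the term at [a0], whose coefficient [l2 - l1] is nonzero. *)
    have := E (('X - (val a2)%:P) * ('X - (val a0)%:P)).
    rewrite !hornerM !hornerXsubC !subrr mulr0 !mul0r mulr0 addr0 => /eqP.
    rewrite -Lk !mulf_eq0 (negbTE s0) orbF !subr_eq0 (negbTE a10) orbF.
    by move/eqP.
  have := E ('X - (val a2)%:P).
  rewrite !hornerXsubC a12 !subrr !mul0r add0r => /esym/eqP.
  by rewrite mulf_eq0 !subr_eq0 eq_sym (negbTE l12) -a12 eq_sym (negbTE a10).
have := a1P p; rewrite Lpk Lk a10 => /eqP; rewrite subr_eq => /eqP ->; ring.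
Qed.

Theorem functional_eval : exists a, forall f, Lambda f = f a.
Proof.
have [a aP] := functional_poly; exists a => f.
have [q qE] := dirichlet_quotient f a.
have -> : f = f a *: dirichlet_one R + mul_poly ('X - (val a)%:P) q.
  apply: dirichlet_ext => u; rewrite dirichletD dirichletZ dirichlet1 mul_polyE qE.
  by rewrite hornerXsubC mulr1.
rewrite LambdaD LambdaZ Lambda1 aP hornerXsubC subrr mul0r addr0.
by rewrite dirichletD dirichletZ dirichlet1 mul_polyE hornerXsubC subrr mul0r addr0.
Qed.

End functional.
End dirichlet_space.

Theorem theorem1p1 (R : realType) (Lambda : {linear dirichlet R -> R[i]})
    (Lambda1 : Lambda (dirichlet_one R) = 1)
    (Lambda_neq0 : forall g : dirichlet R,
       (forall z : disc R, g z != 0) -> Lambda g != 0) :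
  exists a : disc R, forall f : dirichlet R, Lambda f = f a.
Proof. exact: functional_eval. Qed.
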